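(* Let $A=(A_1,R(A))$, $A'=(A_1',R(A'))$, $B=(B_1,R(B))$, $B'=(B_1',R(B'))$ be quadratic data, and let $$pr_{14}:(A_1\oplus A_1')\otimes(B_1\oplus B_1')\to(A_1\otimes B_1)\oplus(A_1'\otimes B_1')$$ be the projection that kills the summands $A_1'\otimes B_1$ and $A_1\otimes B_1'$. Then $pr_{14}^{\otimes2}$ sends the subspace of relations $R\big((A\,\underline{\otimes}\,A')\bullet(B\,\underline{\otimes}\,B')\big)$ into the subspace of relations $R\big((A\bullet B)\,\underline{\otimes}\,(A'\bullet B')\big)$. Hence $pr_{14}$ lifts to an interchange morphism $$\varphi_{AA'BB'}:(A\,\underline{\otimes}\,A')\bullet(B\,\underline{\otimes}\,B')\to(A\bullet B)\,\underline{\otimes}\,(A'\bullet B')$$ in the category $\mathbf{QD}$ of quadratic data, and the quadruple $(\mathbf{QD},\bullet,\underline{\otimes},\varphi)$ forms a lax $2$-monoidal category.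
   Context: Work over a field $K$ of characteristic $\neq2$ with finite dimensional $\mathbb Z$-graded vector spaces, degree $0$ maps, and the Koszul sign rule. An object of $\mathbf{QD}$ is a pair $A=(A_1,R(A))$ with $A_1$ a graded vector space and $R(A)\subset A_1^{\otimes2}$ a subspace; a morphism $A\to B$ is a linear map $f:A_1\to B_1$ with $f^{\otimes2}(R(A))\subset R(B)$. Monoidal structures: $A\bullet B=(A_1\otimes B_1,\ S_{(23)}(R(A)\otimes R(B)))$, where $S_{(23)}:A_1^{\otimes2}\otimes B_1^{\otimes2}\to(A_1\otimes B_1)^{\otimes2}$ exchanges the two middle factors with the Koszul sign (unit $(K,K^{\otimes2})$); and $A\,\underline{\otimes}\,B=(A_1\oplus B_1,\ R(A)\oplus[A_1,B_1]_+\oplus R(B))$, where $[A_1,B_1]_+=\langle a\otimes b+(-1)^{|a||b|}b\otimes a\mid a\in A_1,\ b\in B_1\rangle$ (unit $(0,0)$). Associators and unitors are those of $\otimes$ and $\oplus$ on graded vector spaces. A lax $2$-monoidal category $(\mathbf C,\boxtimes,\otimes,\varphi)$ is a category with two monoidal structures $\boxtimes$ and $\otimes$ such that the functor $\otimes:(\mathbf C,\boxtimes)^2\to(\mathbf C,\boxtimes)$ is lax monoidal, with structure maps given by a natural transformation (interchange law) $\varphi_{AA'BB'}:(A\otimes A')\boxtimes(B\otimes B')\to(A\boxtimes B)\otimes(A'\boxtimes B')$ satisfying the usual compatibilities with the associativity and the unit of $\boxtimes$ (the interchange law is not required to be invertible). Here $(\boxtimes,\otimes)$ is $(\bullet,\underline{\otimes})$.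 *)

(* Defs.v *)
From Stdlib Require Import ProofIrrelevance.
From HB Require Import structures.
From mathcomp Require Import all_boot all_order all_algebra.

Set Implicit Arguments.
Unset Strict Implicit.
Unset Printing Implicit Defensive.

Import GRing.Theory.
Local Open Scope ring_scope.

Record category := Category {
  ob :> Type;
  mor : ob -> ob -> Type;
  idc : forall A, mor A A;
  compo : forall A B C, mor B C -> mor A B -> mor A C;
  comp_idl : forall A B (f : mor A B), compo (idc B) f = f;
  comp_idr : forall A B (f : mor A B), compo f (idc A) = f;
  compA : forall A B C D (h : mor C D) (g : mor B C) (f : mor A B),
    compo h (compo g f) = compo (compo h g) f }.

Arguments mor {c} A B.
Arguments idc {c} A.
Arguments compo {c A B C} g f.

Declare Scope cat_scope.
Delimit Scope cat_scope with cat.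
Notation "g ∘ f" := (compo g f) (at level 40, left associativity) : cat_scope.
Local Open Scope cat_scope.

Record functor (C D : category) := Functor {
  fob :> C -> D;
  fmap : forall A B, mor A B -> mor (fob A) (fob B);
  fmap_id : forall A, fmap (idc A) = idc (fob A);
  fmap_comp : forall A B E (g : mor B E) (f : mor A B),
    fmap (g ∘ f) = fmap g ∘ fmap f }.

Record monoidal (C : category) (ten : C -> C -> C) (I : C) := Monoidal {
  tenm : forall A A' B B', mor A A' -> mor B B' -> mor (ten A B) (ten A' B');
  tenm_id : forall A B, tenm (idc A) (idc B) = idc (ten A B);
  tenm_comp : forall A A' A'' B B' B'' (f' : mor A' A'') (f : mor A A')
      (g' : mor B' B'') (g : mor B B'),
    tenm (f' ∘ f) (g' ∘ g) = tenm f' g' ∘ tenm f g;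

  assoc : forall A B D, mor (ten (ten A B) D) (ten A (ten B D));
  assocV : forall A B D, mor (ten A (ten B D)) (ten (ten A B) D);
  assocK : forall A B D, assocV A B D ∘ assoc A B D = idc _;
  assocVK : forall A B D, assoc A B D ∘ assocV A B D = idc _;
  assoc_nat : forall A A' B B' D D'
      (f : mor A A') (g : mor B B') (h : mor D D'),
    assoc A' B' D' ∘ tenm (tenm f g) h = tenm f (tenm g h) ∘ assoc A B D;

  lunit : forall A, mor (ten I A) A;
  lunitV : forall A, mor A (ten I A);
  lunitK : forall A, lunitV A ∘ lunit A = idc _;
  lunitVK : forall A, lunit A ∘ lunitV A = idc _;
  lunit_nat : forall A A' (f : mor A A'),
    lunit A' ∘ tenm (idc I) f = f ∘ lunit A;

  runit : forall A, mor (ten A I) A;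
  runitV : forall A, mor A (ten A I);
  runitK : forall A, runitV A ∘ runit A = idc _;
  runitVK : forall A, runit A ∘ runitV A = idc _;
  runit_nat : forall A A' (f : mor A A'),
    runit A' ∘ tenm f (idc I) = f ∘ runit A;

  pentagon : forall A B D E,
    assoc A B (ten D E) ∘ assoc (ten A B) D E
    = tenm (idc A) (assoc B D E) ∘ assoc A (ten B D) E
      ∘ tenm (assoc A B D) (idc E);
  triangle : forall A B,
    tenm (idc A) (lunit B) ∘ assoc A I B = tenm (runit A) (idc B) }.

Definition lax_monoidal (C D : category) tC IC tD ID
    (MC : @monoidal C tC IC) (MD : @monoidal D tD ID) (F : functor C D)
    (mu : forall X Y, mor (tD (F X) (F Y)) (F (tC X Y))) : Prop :=
  [/\ forall X X' Y Y' (f : mor X X') (g : mor Y Y'),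
        mu X' Y' ∘ tenm MD (fmap F f) (fmap F g)
        = fmap F (tenm MC f g) ∘ mu X Y,
      forall X Y Z,
        fmap F (assoc MC X Y Z) ∘ mu (tC X Y) Z ∘ tenm MD (mu X Y) (idc (F Z))
        = mu X (tC Y Z) ∘ tenm MD (idc (F X)) (mu Y Z)
          ∘ assoc MD (F X) (F Y) (F Z)
    & exists eta : mor ID (F IC),
        (forall X, fmap F (lunit MC X) ∘ mu IC X ∘ tenm MD eta (idc (F X))
                   = lunit MD (F X)) /\
        (forall X, fmap F (runit MC X) ∘ mu X IC ∘ tenm MD (idc (F X)) eta
                   = runit MD (F X))].

Arguments lax_monoidal {C D tC IC tD ID} MC MD F mu.

#[local] Obligation Tactic := idtac.

Program Definition prod_category (C D : category) : category := {|
  ob := C * D;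
  mor := fun X Y => (mor X.1 Y.1 * mor X.2 Y.2)%type;
  idc := fun X => (idc X.1, idc X.2);
  compo := fun X Y Z g f => (g.1 ∘ f.1, g.2 ∘ f.2) |}.
Next Obligation. by move=> C D X Y [f g]; rewrite /= !comp_idl. Qed.
Next Obligation. by move=> C D X Y [f g]; rewrite /= !comp_idr. Qed.
Next Obligation. by move=> *; rewrite /= !compA. Qed.

Section ProductMonoidal.
Variables (C D : category) (tC : C -> C -> C) (IC : C) (tD : D -> D -> D) (ID : D).
Variables (MC : monoidal tC IC) (MD : monoidal tD ID).

Definition prod_ten (X Y : prod_category C D) : prod_category C D :=
  (tC X.1 Y.1, tD X.2 Y.2).
Definition prod_unit : prod_category C D := (IC, ID).

Program Definition prod_monoidal : monoidal prod_ten prod_unit := {|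
  tenm := fun X X' Y Y' f g => (tenm MC f.1 g.1, tenm MD f.2 g.2);
  assoc := fun X Y Z => (assoc MC X.1 Y.1 Z.1, assoc MD X.2 Y.2 Z.2);
  assocV := fun X Y Z => (assocV MC X.1 Y.1 Z.1, assocV MD X.2 Y.2 Z.2);
  lunit := fun X => (lunit MC X.1, lunit MD X.2);
  lunitV := fun X => (lunitV MC X.1, lunitV MD X.2);
  runit := fun X => (runit MC X.1, runit MD X.2);
  runitV := fun X => (runitV MC X.1, runitV MD X.2) |}.
Next Obligation. by move=> *; rewrite /= !tenm_id. Qed.
Next Obligation. by move=> *; rewrite /= !tenm_comp. Qed.
Next Obligation. by move=> *; rewrite /= !assocK. Qed.
Next Obligation. by move=> *; rewrite /= !assocVK. Qed.
Next Obligation. by move=> *; rewrite /= !assoc_nat. Qed.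
Next Obligation. by move=> *; rewrite /= !lunitK. Qed.
Next Obligation. by move=> *; rewrite /= !lunitVK. Qed.
Next Obligation. by move=> *; rewrite /= !lunit_nat. Qed.
Next Obligation. by move=> *; rewrite /= !runitK. Qed.
Next Obligation. by move=> *; rewrite /= !runitVK. Qed.
Next Obligation. by move=> *; rewrite /= !runit_nat. Qed.
Next Obligation. by move=> *; rewrite /= !pentagon. Qed.
Next Obligation. by move=> *; rewrite /= !triangle. Qed.

End ProductMonoidal.

Program Definition ten_functor (C : category) ten I (M : @monoidal C ten I) :
    functor (prod_category C C) C := {|
  fob := fun X => ten X.1 X.2;
  fmap := fun X Y f => tenm M f.1 f.2 |}.
Next Obligation. by move=> *; exact: tenm_id. Qed.
Next Obligation. by move=> *; exact: tenm_comp. Qed.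

Definition lax_two_monoidal (C : category) box IB ten IT
    (MB : @monoidal C box IB) (MT : @monoidal C ten IT)
    (phi : forall A A' B B' : C,
       mor (box (ten A A') (ten B B')) (ten (box A B) (box A' B'))) : Prop :=
  lax_monoidal (prod_monoidal MB MB) MB (ten_functor MT)
    (fun X Y => phi X.1 X.2 Y.1 Y.2).

Section TensorProduct.
Variables (K : fieldType) (V W : vectType K).

Notation bilinear b := (bilinear_for *:%R *:%R b).

Record tensor_product := TensorProduct {
  tens_car :> vectType K;
  tens_pure : V -> W -> tens_car;
  tens_lift : forall U : vectType K, (V -> W -> U) -> 'Hom(tens_car, U);
  tens_pure_bilinear : bilinear tens_pure;
  tens_liftE : forall (U : vectType K) (b : V -> W -> U), bilinear b ->
    forall v w, tens_lift b (tens_pure v w) = b v w;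
  tens_ext : forall (U : vectType K) (f g : 'Hom(tens_car, U)),
    (forall v w, f (tens_pure v w) = g (tens_pure v w)) -> f = g }.

Let bV := vbasis {: V}.
Let bW := vbasis {: W}.
Let M : vectType K := 'M[K]_(\dim {: V}, \dim {: W}).

Let mpure (v : V) (w : W) : M := \matrix_(i, j) (coord bV i v * coord bW j w).
Let mlift_fun (U : vectType K) (b : V -> W -> U) (m : M) : U :=
  \sum_i \sum_j (m : 'M_(_, _)) i j *: b bV`_i bW`_j.
Let mlift (U : vectType K) (b : V -> W -> U) : 'Hom(M, U) := linfun (mlift_fun b).

Let mlift_lin U b : linear (@mlift_fun U b).
Proof.
move=> c m n; rewrite /mlift_fun scaler_sumr -big_split; apply: eq_bigr => i _.
rewrite scaler_sumr -big_split; apply: eq_bigr => j _.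
by rewrite !mxE scalerDl scalerA.
Qed.

Let mliftE0 U b m : @mlift U b m = mlift_fun b m.
Proof.
pose f : {linear _ -> _} := HB.pack (mlift_fun b)
  (GRing.isLinear.Build _ _ _ _ _ (@mlift_lin U b)).
exact: (lfunE f).
Qed.

Let mpure_bilinear : bilinear mpure.
Proof.
split=> [w c u v|v c u w]; apply/matrixP=> i j; rewrite !mxE linearP /=.
  by rewrite mulrDl mulrA.
by rewrite mulrDr mulrCA.
Qed.

Let mpure_delta (i : 'I_(\dim {: V})) (j : 'I_(\dim {: W})) :
  mpure bV`_i bW`_j = delta_mx i j.
Proof.
apply/matrixP=> k l; rewrite !mxE !coord_free ?(basis_free (vbasisP _)) //.
by rewrite -natrM mulnb; congr (_ (nat_of_bool (_ && _))); exact: eq_sym.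
Qed.

Let mliftE (U : vectType K) (b : V -> W -> U) : bilinear b ->
  forall v w, mlift b (mpure v w) = b v w.
Proof.
move=> [bl br] v w; rewrite mliftE0 /mlift_fun.
pose bv x : {linear _ -> _} := HB.pack (b x) (GRing.isLinear.Build _ _ _ _ _ (br x)).
pose bw y : {linear _ -> _} := HB.pack (b^~ y) (GRing.isLinear.Build _ _ _ _ _ (bl y)).
rewrite [RHS](_ : _ = bw w v) // [X in bw w X](coord_vbasis (memvf v)) linear_sum.
apply: eq_bigr => i _; rewrite linearZ /= [b _ w](_ : _ = bv bV`_i w) //.
rewrite [X in bv _ X](coord_vbasis (memvf w)) linear_sum scaler_sumr.
by apply: eq_bigr => j _; rewrite linearZ /= mxE scalerA.
Qed.

Let mext (U : vectType K) (f g : 'Hom(M, U)) :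
  (forall v w, f (mpure v w) = g (mpure v w)) -> f = g.
Proof.
move=> fg; apply/lfunP => m.
have fgE i j : f (delta_mx i j : M) = g (delta_mx i j : M).
  by rewrite -mpure_delta; exact: fg.
rewrite [m]matrix_sum_delta !linear_sum.
apply: eq_bigr => i _; rewrite !linear_sum; apply: eq_bigr => j _.
by rewrite !linearZ; congr (_ *: _); exact: fgE.
Qed.

(* Opaque: only the universal property is used. *)
Definition tens : tensor_product.
Proof. exact: (TensorProduct mpure_bilinear mliftE mext). Qed.

End TensorProduct.

Arguments tens_lift {K V W} t {U} b.

Notation "v ⊗ w" := (tens_pure (tens _ _) v w) (at level 40, left associativity).

Section VspaceSums.
Variables (K : fieldType) (V : vectType K) (I : eqType) (G : I -> {vspace V}).

Lemma sub_sumv_seq (s : seq I) (P : pred I) i :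
  i \in s -> P i -> (G i <= \sum_(j <- s | P j) G j)%VS.
Proof. by move=> si Pi; rewrite (big_rem i) //= Pi addvSl. Qed.

Lemma sumv_seq_sub (s : seq I) (P : pred I) (U : {vspace V}) :
  (forall i, i \in s -> P i -> (G i <= U)%VS) ->
  (\sum_(j <- s | P j) G j <= U)%VS.
Proof.
move=> sub; rewrite big_seq_cond; apply: (big_ind (fun X => X <= U)%VS).
- exact: sub0v.
- by move=> X Y XU YU; rewrite subv_add XU.
- by move=> i /andP[]; exact: sub.
Qed.

Definition directv_family : Prop :=
  forall s : seq I, uniq s -> directv (\sum_(i <- s) G i).

Lemma directv_proj (P : I -> 'End(V)) :
  (forall i v, v \in G i -> P i v = v) ->
  (forall i j v, j != i -> v \in G j -> P i v = 0) ->
  directv_family.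
Proof.
move=> Pid P0; elim=> [_|i s IH]; first by rewrite directvE /= !big_nil dimv0.
move=> /= /andP[si /IH]; rewrite !directvE /= !big_cons => /eqP <-.
apply/eqP/dimv_disjoint_sum/eqP; rewrite -subv0; apply/subvP => v.
rewrite memv_cap memv0 => /andP[vi vs]; rewrite -(Pid _ _ vi) -memv_ker.
apply: subvP vs; apply: sumv_seq_sub => j sj _; apply/subvP => w wj.
by rewrite memv_ker (P0 i j) //; apply: contraNneq si => <-.
Qed.

End VspaceSums.

Section Graded.
Variable K : fieldType.

(* The family [gr] of homogeneous components, all but finitely many of which
   are zero, is an internal direct sum decomposition. *)
Record gvect := GVect {
  gsort :> vectType K;
  gr : int -> {vspace gsort};
  gr_direct : directv_family gr;
  gr_full : exists s : seq int, (\sum_(n <- s) gr n)%VS == fullv }.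

(* By [gr_out], [gr V] vanishes outside [gsupp V], so a sum over all homogeneous
   degrees can be written as a sum over [gsupp V]. *)
Definition gsupp (V : gvect) : seq int := undup (xchoose (gr_full V)).

Definition gproj (V : gvect) (n : int) : 'End(V) :=
  daddv_pi (gr V n) (\sum_(m <- gsupp V | m != n) gr V m).

Section GradedTheory.
Variable V : gvect.

Lemma gsupp_full : (\sum_(n <- gsupp V) gr V n)%VS = fullv.
Proof.
apply/eqP; rewrite eqEsubv subvf /= -(eqP (xchooseP (gr_full V))).
by apply: sumv_seq_sub => i si _; apply: sub_sumv_seq; rewrite ?mem_undup.
Qed.

Lemma gr_cap n : (gr V n :&: \sum_(m <- gsupp V | m != n) gr V m = 0)%VS.
Proof.
rewrite -big_filter; set s := [seq m <- _ | _].
have us : uniq s by rewrite filter_uniq ?undup_uniq.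
have /(@gr_direct V _) : uniq (n :: s) by rewrite /= us mem_filter eqxx.
move: (@gr_direct V _ us); rewrite !directvE /= !big_cons => /eqP <- /eqP E.
by apply/eqP; rewrite -dimv_eq0 -(eqn_add2l (\dim (gr V n + \sum_(m <- s) gr V m)))
  dimv_sum_cap addn0 E.
Qed.

Lemma gproj_mem n v : gproj V n v \in gr V n.
Proof. exact: memv_pi. Qed.

Lemma gproj_id n v : v \in gr V n -> gproj V n v = v.
Proof. by apply: daddv_pi_id; exact: gr_cap. Qed.

Lemma gproj_comp0 n v :
  v \in (\sum_(m <- gsupp V | m != n) gr V m)%VS -> gproj V n v = 0.
Proof.
move=> vS; have dis := gr_cap n.
have := daddv_pi_add dis (subvP (addvSr _ _) v vS).
rewrite [X in _ + X]daddv_pi_id ?(capvC _ (gr V n)) //.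
by move/(canRL (addrK _)); rewrite subrr.
Qed.

Lemma gr_out n : n \notin gsupp V -> gr V n = 0%VS.
Proof.
move=> sn; rewrite -(gr_cap n) [in RHS]big_seq_cond.
rewrite (eq_bigl (fun m => m \in gsupp V)) => [|m]; last first.
  by case: (boolP (m \in _)) => //= sm; apply: contraNneq sn => <-.
by rewrite -big_seq gsupp_full capvf.
Qed.

Lemma gproj_0 n m v : m != n -> v \in gr V m -> gproj V n v = 0.
Proof.
move=> mn vm; have [sm|sm] := boolP (m \in gsupp V).
  by apply: gproj_comp0; apply: subvP vm; exact: sub_sumv_seq.
by move: vm; rewrite gr_out // memv0 => /eqP ->; rewrite linear0.
Qed.

Lemma gproj_sum v : \sum_(n <- gsupp V) gproj V n v = v.
Proof.
suff /subvP/(_ v (memvf v)) :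
    (fullv <= lker (\sum_(n <- gsupp V) gproj V n - \1%VF)%R)%VS.
  by rewrite memv_ker !lfun_simp subr_eq0 => /eqP.
rewrite -gsupp_full; apply: sumv_seq_sub => i si _; apply/subvP => w wi.
rewrite memv_ker !lfun_simp (bigD1_seq i) ?undup_uniq //=.
rewrite gproj_id // big1 ?addr0 ?subrr // => j ji.
by rewrite (gproj_0 (m := i)) // eq_sym.
Qed.

End GradedTheory.

Definition tsub (V W : vectType K) (U : {vspace V}) (U' : {vspace W}) :
    {vspace tens V W} :=
  <<[seq u ⊗ w | u <- vbasis U, w <- vbasis U']>>%VS.

Definition tmap (V V' W W' : vectType K) (f : 'Hom(V, V')) (g : 'Hom(W, W')) :
    'Hom(tens V W, tens V' W') :=
  tens_lift (tens V W) (fun v w => f v ⊗ g w).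

Section TensorTheory.
Variables V W : vectType K.

Lemma pure_linearl (w : W) : linear (fun v : V => v ⊗ w).
Proof. exact: (tens_pure_bilinear (tens V W)).1. Qed.

Lemma pure_linearr (v : V) : linear (fun w : W => v ⊗ w).
Proof. exact: (tens_pure_bilinear (tens V W)).2. Qed.

Definition purel (w : W) : {linear V -> tens V W} :=
  HB.pack (fun v : V => v ⊗ w) (GRing.isLinear.Build _ _ _ _ _ (pure_linearl w)).
Definition purer (v : V) : {linear W -> tens V W} :=
  HB.pack (fun w : W => v ⊗ w) (GRing.isLinear.Build _ _ _ _ _ (pure_linearr v)).

Lemma tmap_pure (V' W' : vectType K) (f : 'Hom(V, V')) (g : 'Hom(W, W')) v w :
  tmap f g (v ⊗ w) = f v ⊗ g w.
Proof.
rewrite /tmap tens_liftE //; split=> [y c u u'|x c u u'] /=; rewrite linearP.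
  exact: (tens_pure_bilinear (tens V' W')).1.
exact: (tens_pure_bilinear (tens V' W')).2.
Qed.

Lemma mem_tsub (U : {vspace V}) (U' : {vspace W}) u w :
  u \in U -> w \in U' -> u ⊗ w \in tsub U U'.
Proof.
move=> uU wU; rewrite (coord_vbasis uU) (coord_vbasis wU).
rewrite (_ : _ ⊗ _ = purel (\sum_i coord (vbasis U') i w *: (vbasis U')`_i)
  (\sum_i coord (vbasis U) i u *: (vbasis U)`_i)) // linear_sum memv_suml //= => i _.
rewrite -[X in X \in _]/(purer (coord (vbasis U) i u *: (vbasis U)`_i) _).
rewrite linear_sum memv_suml //= => j _.
rewrite -[X in X \in _]/(purel (coord (vbasis U') j w *: (vbasis U')`_j) _).
rewrite linearZ memvZ //=.
rewrite -[X in X \in _]/(purer (vbasis U)`_i _) linearZ memvZ //=.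
by apply/memv_span/allpairs_f; rewrite mem_nth ?size_tuple.
Qed.

Lemma tsub_sub (U : {vspace V}) (U' : {vspace W}) (X : {vspace tens V W}) :
  (forall u w, u \in U -> w \in U' -> u ⊗ w \in X) -> (tsub U U' <= X)%VS.
Proof.
move=> sub; apply/span_subvP => _ /allpairsP[[u w] [/= uU wU ->]].
by apply: sub; exact: vbasis_mem.
Qed.

Lemma tens_full (X : {vspace tens V W}) : (forall v w, v ⊗ w \in X) -> X = fullv.
Proof.
move=> pX; apply/vspaceP => x; rewrite memvf.
have -> : x = projv X x.
  suff -> : projv X = \1%VF by rewrite id_lfunE.
  by apply: tens_ext => v w; rewrite id_lfunE projv_id.
exact: memv_proj.
Qed.

End TensorTheory.

Section GradedTensor.
Variables V W : gvect.

Definition gtens_gr (n : int) : {vspace tens V W} :=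
  (\sum_(i <- gsupp V) \sum_(j <- gsupp W | (i + j)%R == n)
     tsub (gr V i) (gr W j))%VS.

Let proj (n : int) : 'End(tens V W) :=
  \sum_(i <- gsupp V) \sum_(j <- gsupp W | i + j == n)
     tmap (gproj V i) (gproj W j).

Let projE n m : (gtens_gr m <= lker (proj n - (m == n)%:R *: \1%VF)%R)%VS.
Proof.
apply: sumv_seq_sub => i si _; apply: sumv_seq_sub => j sj /eqP <-.
apply: tsub_sub => v w vi wj; rewrite memv_ker !lfun_simp /=.
have z0 (a : V) : a ⊗ (0 : W) = 0 by exact: (linear0 (purer W a)).
have z0' (a : W) : (0 : V) ⊗ a = 0 by exact: (linear0 (purel V a)).
rewrite (bigD1_seq i) ?undup_uniq //= [X in _ + X - _]big1 => [|k ki]; last first.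
  rewrite sum_lfunE big1 // => l _.
  by rewrite tmap_pure (gproj_0 _ vi) 1?eq_sym.
rewrite addr0 sum_lfunE big_mkcond (bigD1_seq j) ?undup_uniq //=.
rewrite [X in _ + X - _]big1 => [|l lj]; last first.
  by rewrite tmap_pure (gproj_0 _ wj) 1?eq_sym // z0 if_same.
rewrite tmap_pure !gproj_id // addr0; case: (_ == n).
  by rewrite mulr1n scale1r subrr.
by rewrite mulr0n scale0r subrr.
Qed.

Lemma gtens_direct : directv_family gtens_gr.
Proof.
apply: (directv_proj (P := proj)) => [n|n m] v.
  move=> /(subvP (projE n n)); rewrite memv_ker !lfun_simp eqxx scale1r subr_eq0.
  by move/eqP.
move=> /negPf mn /(subvP (projE n m)).
by rewrite memv_ker !lfun_simp mn scale0r subr0 => /eqP.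
Qed.

Lemma gtens_full : exists s, (\sum_(n <- s) gtens_gr n)%VS == fullv.
Proof.
exists [seq i + j | i <- gsupp V, j <- gsupp W]; apply/eqP/tens_full => v w.
rewrite -(gproj_sum v) -(gproj_sum w).
rewrite -[X in X \in _]/(purel V _ _) linear_sum big_seq memv_suml //= => i si.
rewrite -[X in X \in _]/(purer W _ _) linear_sum big_seq memv_suml //= => j sj.
apply: subvP (mem_tsub (gproj_mem i v) (gproj_mem j w)).
apply: subv_trans (sub_sumv_seq _ (allpairs_f _ si sj) _) => //.
apply: subv_trans (sub_sumv_seq _ si _) => //.
exact: (sub_sumv_seq (fun j => tsub (gr V i) (gr W j)) sj).
Qed.

Definition gtens : gvect := GVect gtens_direct gtens_full.

End GradedTensor.

Definition dsum (V W : vectType K) : vectType K :=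
  Vector.clone K (V * W)%type _.
Definition ground : vectType K := Vector.clone K K^o _.
Definition nullv : vectType K := Vector.clone K 'rV[K]_0 _.

Definition sinl (V W : vectType K) : 'Hom(V, dsum V W) := linfun (fun v => (v, 0)).
Definition sinr (V W : vectType K) : 'Hom(W, dsum V W) := linfun (fun w => (0, w)).
Definition smap (V V' W W' : vectType K) (f : 'Hom(V, V')) (g : 'Hom(W, W')) :
    'Hom(dsum V W, dsum V' W') :=
  linfun (fun x => (f x.1, g x.2)).

Section SumTheory.
Variables V W : vectType K.

Let sinl_linear : linear (fun v : V => (v, 0) : dsum V W).
Proof. by move=> c u v; rewrite -[RHS]/(_, _) /= scaler0 addr0. Qed.
Let sinr_linear : linear (fun w : W => (0, w) : dsum V W).
Proof. by move=> c u v; rewrite -[RHS]/(_, _) /= scaler0 addr0. Qed.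

Lemma sinlE v : sinl V W v = (v, 0).
Proof.
pose f : {linear _ -> _} := HB.pack (fun v : V => (v, 0) : dsum V W)
  (GRing.isLinear.Build _ _ _ _ _ sinl_linear).
exact: (lfunE f).
Qed.

Lemma sinrE w : sinr V W w = (0, w).
Proof.
pose f : {linear _ -> _} := HB.pack (fun w : W => (0, w) : dsum V W)
  (GRing.isLinear.Build _ _ _ _ _ sinr_linear).
exact: (lfunE f).
Qed.

Lemma smapE (V' W' : vectType K) (f : 'Hom(V, V')) (g : 'Hom(W, W')) x :
  smap f g x = (f x.1, g x.2).
Proof.
have h_lin : linear (fun x : dsum V W => (f x.1, g x.2) : dsum V' W').
  by move=> c [u v] [u' v']; rewrite /= !linearP.
pose h : {linear _ -> _} :=
  HB.pack (fun x : dsum V W => (f x.1, g x.2) : dsum V' W')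
  (GRing.isLinear.Build _ _ _ _ _ h_lin).
exact: (lfunE h).
Qed.

End SumTheory.

Section GradedSum.
Variables V W : gvect.

Definition gsum_gr (n : int) : {vspace dsum V W} :=
  (sinl V W @: gr V n + sinr V W @: gr W n)%VS.

Let gsum_grP n x : x \in gsum_gr n -> x.1 \in gr V n /\ x.2 \in gr W n.
Proof.
case/memv_addP => _ /memv_imgP[v vn ->] [_ /memv_imgP[w wn ->] ->].
by rewrite sinlE sinrE /= addr0 add0r.
Qed.

Lemma gsum_direct : directv_family gsum_gr.
Proof.
apply: (directv_proj (P := fun n => smap (gproj V n) (gproj W n))) => [n|n m] [v w].
  by case/gsum_grP => /= vn wn; rewrite smapE /= !gproj_id.
by move=> mn /gsum_grP[/= vm wm]; rewrite smapE /= !(gproj_0 mn).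
Qed.

Lemma gsum_full : exists s, (\sum_(n <- s) gsum_gr n)%VS == fullv.
Proof.
exists (gsupp V ++ gsupp W); apply/eqP/vspaceP => -[v w]; rewrite memvf.
have -> : (v, w) = sinl V W v + sinr V W w.
  by rewrite sinlE sinrE; congr (_, _); rewrite /= ?addr0 ?add0r.
rewrite -(gproj_sum v) -(gproj_sum w) !linear_sum.
apply: memvD; rewrite big_seq memv_suml // => i si.
  apply: subvP (memv_img _ (gproj_mem i v)); apply: subv_trans (addvSl _ _) _.
  by apply: (sub_sumv_seq gsum_gr); rewrite // mem_cat si.
apply: subvP (memv_img _ (gproj_mem i w)); apply: subv_trans (addvSr _ _) _.
by apply: (sub_sumv_seq gsum_gr); rewrite // mem_cat si orbT.
Qed.

Definition gsum : gvect := GVect gsum_direct gsum_full.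

End GradedSum.

Definition gone_gr (n : int) : {vspace ground} := if n == 0 then fullv else 0%VS.

Lemma gone_direct : directv_family gone_gr.
Proof.
apply: (directv_proj (P := fun n => if n == 0 then \1%VF else 0)) => [n|n m] v.
  by rewrite /gone_gr; case: eqP => _; rewrite ?memv0 ?lfunE //= => /eqP ->.
rewrite /gone_gr => mn; case: (m =P 0) => [m0 _|_]; last first.
  by rewrite memv0 => /eqP ->; rewrite linear0.
by rewrite ifN ?lfunE // -m0 eq_sym.
Qed.

Lemma gone_full : exists s, (\sum_(n <- s) gone_gr n)%VS == fullv.
Proof. by exists [:: 0]; rewrite big_seq1. Qed.

Definition gone : gvect := GVect gone_direct gone_full.

Definition gzero_gr (n : int) : {vspace nullv} := 0%VS.

Lemma gzero_direct : directv_family gzero_gr.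
Proof.
by apply: (directv_proj (P := fun=> \1%VF)) => [n|n m] v; rewrite ?lfunE // memv0 => _ /eqP.
Qed.

Lemma gzero_full : exists s, (\sum_(n <- s) gzero_gr n)%VS == fullv.
Proof.
exists [::]; rewrite big_nil; apply/eqP/vspaceP => v.
by rewrite memvf [v]thinmx0 mem0v.
Qed.

Definition gzero : gvect := GVect gzero_direct gzero_full.

Definition tassoc (U V W : vectType K) :
    'Hom(tens (tens U V) W, tens U (tens V W)) :=
  tens_lift _ (fun x w => tens_lift _ (fun u v => u ⊗ (v ⊗ w)) x).
Definition tlunit (V : vectType K) : 'Hom(tens ground V, V) :=
  tens_lift (tens ground V) (fun c v => (c : K) *: v).
Definition trunit (V : vectType K) : 'Hom(tens V ground, V) :=
  tens_lift (tens V ground) (fun v c => (c : K) *: v).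

Definition sassoc (U V W : vectType K) :
    'Hom(dsum (dsum U V) W, dsum U (dsum V W)) :=
  linfun (fun x => (x.1.1, (x.1.2, x.2))).
Definition slunit (V : vectType K) : 'Hom(dsum nullv V, V) := linfun snd.
Definition srunit (V : vectType K) : 'Hom(dsum V nullv, V) := linfun fst.

(* (a ⊗ a') ⊗ (b ⊗ b') |-> (-1)^(|a'||b|) (a ⊗ b) ⊗ (a' ⊗ b') for homogeneous
   a' and b, see [S23_pure]; a' and b are expanded in homogeneous components. *)
Definition S23 (A A' B B' : gvect) :
    'Hom(tens (tens A A') (tens B B'), tens (tens A B) (tens A' B')) :=
  tens_lift _ (fun x y =>
    tens_lift _ (fun a a' =>
      tens_lift _ (fun b b' =>
        \sum_(i <- gsupp A') \sum_(j <- gsupp B)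
          (-1) ^ (i * j) *: ((a ⊗ gproj B j b) ⊗ (gproj A' i a' ⊗ b'))) y) x).

Lemma S23_pure (A A' B B' : gvect) (i j : int) (a : A) (a' : A') (b : B) (b' : B') :
  a' \in gr A' i -> b \in gr B j ->
  S23 A A' B B' ((a ⊗ a') ⊗ (b ⊗ b')) = (-1) ^ (i * j) *: ((a ⊗ b) ⊗ (a' ⊗ b')).
Proof.
move=> a'i bj.
have pl (V W : vectType K) c (u v : V) (w : W) :
  (c *: u + v) ⊗ w = c *: (u ⊗ w) + v ⊗ w by exact: (linearP (purel V w)).
have pr (V W : vectType K) c (v : V) (u w : W) :
  v ⊗ (c *: u + w) = c *: (v ⊗ u) + v ⊗ w by exact: (linearP (purer W v)).
have sumP (I : Type) (s : seq I) (V : vectType K) c (f g : I -> V) :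
  \sum_(k <- s) (c *: f k + g k) = c *: \sum_(k <- s) f k + \sum_(k <- s) g k.
  by rewrite big_split scaler_sumr.
pose F a a' b b' := \sum_(i <- gsupp A') \sum_(j <- gsupp B)
  (-1) ^ (i * j) *: ((a ⊗ gproj B j b) ⊗ (gproj A' i a' ⊗ b'))
    : tens (tens A B) (tens A' B').
have F1 a'0 b0 b'0 : linear (fun a0 : A => F a0 a'0 b0 b'0).
  move=> c u v; rewrite -sumP; apply: eq_bigr => k _; rewrite -sumP.
  by apply: eq_bigr => l _; rewrite !pl scalerDr !scalerA [_ * c]mulrC.
have F2 a0 b0 b'0 : linear (fun a'0 : A' => F a0 a'0 b0 b'0).
  move=> c u v; rewrite -sumP; apply: eq_bigr => k _; rewrite -sumP.
  by apply: eq_bigr => l _; rewrite linearP !pl !pr scalerDr !scalerA [_ * c]mulrC.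
have F3 a0 a'0 b'0 : linear (fun b0 : B => F a0 a'0 b0 b'0).
  move=> c u v; rewrite -sumP; apply: eq_bigr => k _; rewrite -sumP.
  by apply: eq_bigr => l _; rewrite linearP !pr !pl scalerDr !scalerA [_ * c]mulrC.
have F4 a0 a'0 b0 : linear (fun b'0 : B' => F a0 a'0 b0 b'0).
  move=> c u v; rewrite -sumP; apply: eq_bigr => k _; rewrite -sumP.
  by apply: eq_bigr => l _; rewrite !pr scalerDr !scalerA [_ * c]mulrC.
have G1 a0 a'0 (b0 : B) (b'0 : B') :
    tens_lift (tens B B') (F a0 a'0) (b0 ⊗ b'0) = F a0 a'0 b0 b'0.
  by apply: tens_liftE; split=> ? ? ? ?; rewrite ?F3 ?F4.
have lext (c : K) (U : vectType K) (f g h : 'Hom(tens B B', U)) y :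
    (forall b b', h (b ⊗ b') = c *: f (b ⊗ b') + g (b ⊗ b')) ->
    h y = c *: f y + g y.
  move=> E; suff -> : h = c *: f + g by rewrite !lfun_simp.
  by apply: tens_ext => b0 b'0; rewrite E !lfun_simp.
have H1 y (a0 : A) (a'0 : A') :
    tens_lift (tens A A') (fun a a' => tens_lift (tens B B') (F a a') y) (a0 ⊗ a'0)
    = tens_lift (tens B B') (F a0 a'0) y.
  apply: (@tens_liftE _ _ _ (tens A A') _ (fun a a' => tens_lift (tens B B') (F a a') y)).
  by split=> [a1 c u v|a1 c u v] /=; apply: lext => b0 b'0; rewrite !G1 ?F1 ?F2.
rewrite /S23 tens_liftE; last first.
  split=> [y c u v|x c u v] /=; first by rewrite linearP.
  have lext2 (f g h : 'Hom(tens A A', tens (tens A B) (tens A' B'))) :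
    (forall a a', h (a ⊗ a') = c *: f (a ⊗ a') + g (a ⊗ a')) ->
    h x = c *: f x + g x.
    move=> E; suff -> : h = c *: f + g by rewrite !lfun_simp.
    by apply: tens_ext => a0 a'0; rewrite E !lfun_simp.
  by apply: lext2 => a0 a'0; rewrite !H1 linearP.
rewrite -/(F) H1 G1 /F.
have z1 (V W : vectType K) (v : V) : v ⊗ (0 : W) = 0 by exact: (linear0 (purer W v)).
have z2 (V W : vectType K) (w : W) : (0 : V) ⊗ w = 0 by exact: (linear0 (purel V w)).
have [si|si] := boolP (i \in gsupp A'); last first.
  have a0 : a' = 0 by move: a'i; rewrite gr_out // memv0 => /eqP.
  rewrite a0 z2 z1 scaler0 big1 // => k _; rewrite big1 // => l _.
  by rewrite linear0 z2 z1 scaler0.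
have [sj|sj] := boolP (j \in gsupp B); last first.
  have b0 : b = 0 by move: bj; rewrite gr_out // memv0 => /eqP.
  rewrite b0 z1 z2 scaler0 big1 // => k _; rewrite big1 // => l _.
  by rewrite linear0 z1 z2 scaler0.
rewrite (bigD1_seq i) ?undup_uniq //= [X in _ + X]big1 => [|k ki]; last first.
  by rewrite big1 // => l _; rewrite (gproj_0 _ a'i) 1?eq_sym // z2 z1 scaler0.
rewrite addr0 (bigD1_seq j) ?undup_uniq //= [X in _ + X]big1 => [|l lj]; last first.
  by rewrite (gproj_0 _ bj) 1?eq_sym // z1 z2 scaler0.
by rewrite addr0 !gproj_id.
Qed.

(* The span [A, B]_+ of the a ⊗ b + (-1)^(|a||b|) b ⊗ a for homogeneous a, b;
   by bilinearity a and b may be taken in bases of the components. *)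
Definition bracket_plus (A B : gvect) : {vspace tens (gsum A B) (gsum A B)} :=
  (\sum_(i <- gsupp A) \sum_(j <- gsupp B)
    <<[seq (sinl A B a ⊗ sinr A B b + (-1) ^ (i * j) *: (sinr A B b ⊗ sinl A B a))%R
        | a <- vbasis (gr A i), b <- vbasis (gr B j)]>>)%VS.

Definition pr14 (A A' B B' : vectType K) :
    'Hom(tens (dsum A A') (dsum B B'), dsum (tens A B) (tens A' B')) :=
  tens_lift _ (fun x y => (x.1 ⊗ y.1, x.2 ⊗ y.2)).

End Graded.

Arguments gone {K}.
Arguments gzero {K}.

Record quad_data (K : fieldType) := QuadData {
  qgen : gvect K;
  qrel : {vspace tens qgen qgen} }.

Record qd_mor (K : fieldType) (A B : quad_data K) := QdMor {
  qd_map : 'Hom(qgen A, qgen B);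
  qd_deg0 : forall n, (qd_map @: gr (qgen A) n <= gr (qgen B) n)%VS;
  qd_rel : (tmap qd_map qd_map @: qrel A <= qrel B)%VS }.

Section QuadraticData.
Variable K : fieldType.

Lemma qd_mor_inj (A B : quad_data K) (f g : qd_mor A B) :
  qd_map f = qd_map g -> f = g.
Proof.
case: f g => [f df rf] [g dg rg] /= fg; case: g / fg in dg rg *.
by rewrite (proof_irrelevance _ df dg) (proof_irrelevance _ rf rg).
Qed.

Lemma tmap_id (V W : vectType K) : tmap (\1 : 'End(V))%VF (\1 : 'End(W))%VF = \1%VF.
Proof. by apply: tens_ext => v w; rewrite tmap_pure !id_lfunE. Qed.

Lemma tmap_comp (V V' V'' W W' W'' : vectType K) (f' : 'Hom(V', V''))
    (f : 'Hom(V, V')) (g' : 'Hom(W', W'')) (g : 'Hom(W, W')) :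
  tmap (f' \o f)%VF (g' \o g)%VF = (tmap f' g' \o tmap f g)%VF.
Proof. by apply: tens_ext => v w; rewrite comp_lfunE !tmap_pure !comp_lfunE. Qed.

Program Definition qd_id (A : quad_data K) : qd_mor A A :=
  {| qd_map := \1%VF |}.
Next Obligation. by move=> A n; rewrite lim1g. Qed.
Next Obligation. by move=> A; rewrite tmap_id lim1g. Qed.

Program Definition qd_comp (A B C : quad_data K) (g : qd_mor B C) (f : qd_mor A B) :
    qd_mor A C :=
  {| qd_map := (qd_map g \o qd_map f)%VF |}.
Next Obligation.
move=> A B C g f n; rewrite limg_comp.
exact: subv_trans (limgS _ (qd_deg0 f n)) (qd_deg0 g n).
Qed.
Next Obligation.
move=> A B C g f; rewrite tmap_comp limg_comp.
exact: subv_trans (limgS _ (qd_rel f)) (qd_rel g).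
Qed.

Program Definition QD : category := {|
  ob := quad_data K;
  mor := @qd_mor K;
  idc := qd_id;
  compo := qd_comp |}.
Next Obligation. by move=> A B f; apply: qd_mor_inj; rewrite /= comp_lfun1l. Qed.
Next Obligation. by move=> A B f; apply: qd_mor_inj; rewrite /= comp_lfun1r. Qed.
Next Obligation. by move=> *; apply: qd_mor_inj; rewrite /= comp_lfunA. Qed.

Definition bullet (A B : QD) : QD :=
  @QuadData K (gtens (qgen A) (qgen B))
    (S23 (qgen A) (qgen A) (qgen B) (qgen B) @: tsub (qrel A) (qrel B))%VS.

Definition bullet_unit : QD := @QuadData K gone fullv.

Definition uten (A B : QD) : QD :=
  @QuadData K (gsum (qgen A) (qgen B))
    (tmap (sinl (qgen A) (qgen B)) (sinl (qgen A) (qgen B)) @: qrel A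
     + bracket_plus (qgen A) (qgen B)
     + tmap (sinr (qgen A) (qgen B)) (sinr (qgen A) (qgen B)) @: qrel B)%VS.

Definition uten_unit : QD := @QuadData K gzero 0%VS.

(* By [qd_mor_inj], a monoidal structure satisfying [bullet_structure] or
   [uten_structure] has its morphism part, associator and unitors uniquely
   determined. *)
Definition bullet_structure (M : monoidal bullet bullet_unit) : Prop :=
  [/\ forall A A' B B' (f : mor A A') (g : mor B B'),
        qd_map (tenm M f g) = tmap (qd_map f) (qd_map g),
      forall A B C : QD,
        qd_map (assoc M A B C) = tassoc (qgen A) (qgen B) (qgen C),
      forall A : QD, qd_map (lunit M A) = tlunit (qgen A)
    & forall A : QD, qd_map (runit M A) = trunit (qgen A)].

Definition uten_structure (M : monoidal uten uten_unit) : Prop :=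
  [/\ forall A A' B B' (f : mor A A') (g : mor B B'),
        qd_map (tenm M f g) = smap (qd_map f) (qd_map g),
      forall A B C : QD,
        qd_map (assoc M A B C) = sassoc (qgen A) (qgen B) (qgen C),
      forall A : QD, qd_map (lunit M A) = slunit (qgen A)
    & forall A : QD, qd_map (runit M A) = srunit (qgen A)].

End QuadraticData.

(* Main.v *)
Require Import Defs.
From HB Require Import structures.
From mathcomp Require Import all_boot all_order all_algebra.
From mathcomp Require Import ring.

(** The projection pr14 only picks the two diagonal components of a tensor
    product of direct sums, so it commutes with the associators and is natural
    for purely linear reasons; these equations are read off on pure tensors
    ([pr14_pure]).  The content is that all the maps involved preserve relations.

    Every relation space is described by generators ([spanned_bullet],
    [spanned_uten]), and every identity between linear maps is checked on
    homogeneous pure tensors ([gspanned_ext]), where the Koszul signs are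
    explicit.  Two facts on the exchange S23 of the middle factors carry the
    proof: it is natural for maps of degree 0 ([S23_nat]), and it is coherent
    with the associator ([S23_assoc]).  The second gives the associator of the
    bullet product.  The first gives the bullet product of morphisms, and the
    interchange law as follows ([pr14_rel]).

    A relation of the sum of A and A' is the image of a relation of A or of A'
    under an inclusion, or an anticommutator, that is a sum of two tensors with
    one factor in each summand.  After S23, the projection sees the first factor
    on the A-side paired with the first on the B-side, and the second with the
    second; it kills the pairs that come from summands of different index.  What
    remains is: relations of A with relations of B, which give relations of their
    bullet product; likewise for A' and B'; and anticommutators with
    anticommutators.  For the latter, modulo 2,

      |a||a'| + |b||b'| + |a||b'| = |a'||b| + (|a| + |b|)(|a'| + |b'|),

    so the two terms that survive form, up to a sign, the anticommutator of
    a ⊗ b and a' ⊗ b'.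

    The unit constraint is the diagonal of the ground field ([unit_diagonal]). *)

Set Implicit Arguments.
Unset Strict Implicit.
Unset Printing Implicit Defensive.

Import GRing.Theory.
Local Open Scope ring_scope.

#[local] Obligation Tactic := idtac.

(** * Spanning sets *)

Section Spanning.
Variable K : fieldType.

(** Generation is phrased as an upper bound on U, rather than by the span of a
    sequence, because S is often an infinite set, such as that of all homogeneous
    pure tensors. *)
Definition spanned (V : vectType K) (U : {vspace V}) (S : V -> Prop) : Prop :=
  forall X : {vspace V}, (forall v, S v -> v \in X) -> (U <= X)%VS.

Section Linear.
Variables V W Z : vectType K.

Lemma limg_subP (f : 'Hom(V, W)) (U : {vspace V}) (X : {vspace W}) :
  reflect (forall v, v \in U -> f v \in X) (f @: U <= X)%VS.
Proof.
apply: (iffP subvP) => [sub v vU|sub _ /memv_imgP[v vU ->]]; last exact: sub.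
exact/sub/memv_img.
Qed.

Lemma spanned_img (f : 'Hom(V, W)) (U : {vspace V}) (S : V -> Prop) (X : {vspace W}) :
  spanned U S -> (forall v, S v -> f v \in X) -> (f @: U <= X)%VS.
Proof.
move=> US SX; apply/limg_subP => v vU; rewrite memv_preim.
by apply: subvP vU; apply: US => u /SX; rewrite -memv_preim.
Qed.

(** Fixing one variable at a time, the preimage of X under a linear map is a
    subspace that contains the generators. *)
Lemma spanned_bilinear (b : V -> W -> Z) (U : {vspace V}) (U' : {vspace W})
    (S : V -> Prop) (T : W -> Prop) (X : {vspace Z}) :
    bilinear_for *:%R *:%R b -> spanned U S -> spanned U' T ->
    (forall v w, S v -> T w -> b v w \in X) ->
  forall v w, v \in U -> w \in U' -> b v w \in X.
Proof.
move=> [bl br] US U'T ST v w vU wU'.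
pose bv v : {linear _ -> _} := HB.pack (b v) (GRing.isLinear.Build _ _ _ _ _ (br v)).
pose bw w : {linear _ -> _} := HB.pack (b^~ w) (GRing.isLinear.Build _ _ _ _ _ (bl w)).
have bvE x y : linfun (bv x) y = b x y by exact: lfunE.
have bwE x y : linfun (bw y) x = b x y by exact: lfunE.
rewrite -bwE memv_preim; apply: subvP vU; apply: US => x Sx.
rewrite -memv_preim bwE -bvE memv_preim; apply: subvP wU'; apply: U'T => y Ty.
by rewrite -memv_preim bvE; exact: ST.
Qed.

Lemma pure_bilinear : bilinear_for *:%R *:%R (fun (v : V) (w : W) => v ⊗ w).
Proof. exact: tens_pure_bilinear. Qed.

Lemma pure0l (w : W) : (0 : V) ⊗ w = 0. Proof. exact: (linear0 (purel V w)). Qed.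
Lemma pure0r (v : V) : v ⊗ (0 : W) = 0. Proof. exact: (linear0 (purer W v)). Qed.
Lemma pureDl (v v' : V) (w : W) : (v + v') ⊗ w = v ⊗ w + v' ⊗ w.
Proof. exact: (linearD (purel V w)). Qed.
Lemma pureDr (v : V) (w w' : W) : v ⊗ (w + w') = v ⊗ w + v ⊗ w'.
Proof. exact: (linearD (purer W v)). Qed.
Lemma pureZl c (v : V) (w : W) : (c *: v) ⊗ w = c *: (v ⊗ w).
Proof. exact: (linearZ_LR (purel V w)). Qed.
Lemma pureZr c (v : V) (w : W) : v ⊗ (c *: w) = c *: (v ⊗ w).
Proof. exact: (linearZ_LR (purer W v)). Qed.

End Linear.

(** * Structure maps on pure tensors *)

Lemma tmap0l (V V' W W' : vectType K) (g : 'Hom(W, W')) : tmap (0 : 'Hom(V, V')) g = 0.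
Proof. by apply: tens_ext => v w; rewrite tmap_pure !lfunE /= pure0l. Qed.
Lemma tmap0r (V V' W W' : vectType K) (f : 'Hom(V, V')) : tmap f (0 : 'Hom(W, W')) = 0.
Proof. by apply: tens_ext => v w; rewrite tmap_pure !lfunE /= pure0r. Qed.

(** Lets the universal property be applied twice, as for maps out of an
    iterated tensor product. *)
Lemma tens_lift_linear (V W Z T : vectType K) (b : T -> V -> W -> Z) :
    (forall t, bilinear_for *:%R *:%R (b t)) ->
    (forall v w, linear (fun t => b t v w)) ->
  forall x, linear (fun t => tens_lift (tens V W) (b t) x).
Proof.
move=> bil lin x c t t'.
suff -> : tens_lift (tens V W) (b (c *: t + t'))
    = c *: tens_lift (tens V W) (b t) + tens_lift (tens V W) (b t').
  by rewrite !lfun_simp.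
by apply: tens_ext => v w; rewrite !lfun_simp !tens_liftE ?lin.
Qed.

Lemma tassoc_pure (U V W : vectType K) (u : U) (v : V) (w : W) :
  tassoc U V W ((u ⊗ v) ⊗ w) = u ⊗ (v ⊗ w).
Proof.
have bil w' : bilinear_for *:%R *:%R (fun (u : U) (v : V) => u ⊗ (v ⊗ w')).
  by split=> [v' c x y|u' c x y] /=; rewrite ?(pureDl, pureDr, pureZl, pureZr).
rewrite /tassoc !tens_liftE //; split=> [w' c x y|x]; first exact: linearP.
apply: tens_lift_linear => // u' v' c y z.
by rewrite !(pureDl, pureDr, pureZl, pureZr).
Qed.

Definition tassocV (U V W : vectType K) :
    'Hom(tens U (tens V W), tens (tens U V) W) :=
  tens_lift _ (fun u y => tens_lift _ (fun v w => (u ⊗ v) ⊗ w) y).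

Lemma tassocV_pure (U V W : vectType K) (u : U) (v : V) (w : W) :
  tassocV U V W (u ⊗ (v ⊗ w)) = (u ⊗ v) ⊗ w.
Proof.
have bil u' : bilinear_for *:%R *:%R (fun (v : V) (w : W) => (u' ⊗ v) ⊗ w).
  by split=> [v' c x y|w' c x y] /=; rewrite ?(pureDl, pureDr, pureZl, pureZr).
rewrite /tassocV !tens_liftE //; split=> [y|u' c x y]; last exact: linearP.
apply: tens_lift_linear => // v' w' c x z.
by rewrite !(pureDl, pureDr, pureZl, pureZr).
Qed.

Lemma tlunit_pure (V : vectType K) (c : ground K) (v : V) :
  tlunit V (c ⊗ v) = (c : K) *: v.
Proof.
rewrite /tlunit tens_liftE //; split=> [w d x y|w d x y] /=.
  by rewrite scalerDl -scalerA.
by rewrite scalerDr !scalerA mulrC.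
Qed.

Lemma trunit_pure (V : vectType K) (c : ground K) (v : V) :
  trunit V (v ⊗ c) = (c : K) *: v.
Proof.
rewrite /trunit tens_liftE //; split=> [w d x y|w d x y] /=.
  by rewrite scalerDr !scalerA mulrC.
by rewrite scalerDl -scalerA.
Qed.

Lemma pr14_pure (A A' B B' : vectType K) (x : dsum A A') (y : dsum B B') :
  pr14 A A' B B' (x ⊗ y) = (x.1 ⊗ y.1, x.2 ⊗ y.2).
Proof.
rewrite /pr14 tens_liftE //.
by split=> [[b b'] c [a a'] [d d']|[a a'] c [b b'] [d d']] /=;
  rewrite !(pureDl, pureDr, pureZl, pureZr).
Qed.

Section Pr14Summands.
Variables A A' B B' : vectType K.

Lemma pr14_ll (a : A) (b : B) :
  pr14 A A' B B' (sinl A A' a ⊗ sinl B B' b) = sinl (tens A B) (tens A' B') (a ⊗ b).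
Proof. by rewrite pr14_pure !sinlE /= pure0l. Qed.
Lemma pr14_lr (a : A) (b' : B') : pr14 A A' B B' (sinl A A' a ⊗ sinr B B' b') = 0.
Proof. by rewrite pr14_pure sinlE sinrE /= pure0l pure0r. Qed.
Lemma pr14_rl (a' : A') (b : B) : pr14 A A' B B' (sinr A A' a' ⊗ sinl B B' b) = 0.
Proof. by rewrite pr14_pure sinlE sinrE /= pure0l pure0r. Qed.
Lemma pr14_rr (a' : A') (b' : B') :
  pr14 A A' B B' (sinr A A' a' ⊗ sinr B B' b') = sinr (tens A B) (tens A' B') (a' ⊗ b').
Proof. by rewrite pr14_pure !sinrE /= pure0l. Qed.

End Pr14Summands.

Lemma sassocE (U V W : vectType K) (x : dsum (dsum U V) W) :
  sassoc U V W x = (x.1.1, (x.1.2, x.2)).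
Proof.
have f_lin : linear (fun x : dsum (dsum U V) W => (x.1.1, (x.1.2, x.2)) : dsum U (dsum V W)).
  by move=> c [[u v] w] [[u' v'] w'].
pose f : {linear _ -> _} := HB.pack
  (fun x : dsum (dsum U V) W => (x.1.1, (x.1.2, x.2)) : dsum U (dsum V W))
  (GRing.isLinear.Build _ _ _ _ _ f_lin).
exact: (lfunE f).
Qed.

Definition sassocV (U V W : vectType K) :
    'Hom(dsum U (dsum V W), dsum (dsum U V) W) :=
  linfun (fun x => ((x.1, x.2.1), x.2.2)).

Lemma sassocVE (U V W : vectType K) (x : dsum U (dsum V W)) :
  sassocV U V W x = ((x.1, x.2.1), x.2.2).
Proof.
have f_lin : linear (fun x : dsum U (dsum V W) => ((x.1, x.2.1), x.2.2) : dsum (dsum U V) W).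
  by move=> c [u [v w]] [u' [v' w']].
pose f : {linear _ -> _} := HB.pack
  (fun x : dsum U (dsum V W) => ((x.1, x.2.1), x.2.2) : dsum (dsum U V) W)
  (GRing.isLinear.Build _ _ _ _ _ f_lin).
exact: (lfunE f).
Qed.

Lemma slunitE (V : vectType K) (x : dsum (nullv K) V) : slunit V x = x.2.
Proof. exact: lfunE. Qed.
Lemma srunitE (V : vectType K) (x : dsum V (nullv K)) : srunit V x = x.1.
Proof. exact: lfunE. Qed.

End Spanning.

(** * Homogeneous spanning families *)

Section GradedSpanning.
Variable K : fieldType.
Implicit Types U V W A B C : gvect K.

Definition gspanned V (S : int -> V -> Prop) : Prop :=
  forall n, spanned (gr V n) (S n).

Definition homog V (n : int) (v : V) : Prop := v \in gr V n.

Lemma gspanned_homog V : gspanned (@homog V).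
Proof. by move=> n X sub; apply/subvP. Qed.
Arguments gspanned_homog : clear implicits.

(** Linear maps are compared on homogeneous generators, where Koszul signs are
    explicit; with [gspanned_pure] these can be taken to be iterated pure tensors
    of any bracketing. *)
Lemma gspanned_ext V (W : vectType K) S (f g : 'Hom(V, W)) :
  gspanned S -> (forall n v, S n v -> f v = g v) -> f = g.
Proof.
move=> VS fg; apply/lfunP => v.
have /subvP/(_ v (memvf v)) : (fullv <= lker (f - g))%VS.
  rewrite -gsupp_full; apply: sumv_seq_sub => n _ _; apply: VS => u Su.
  by rewrite memv_ker !lfun_simp (fg _ _ Su) subrr.
by rewrite memv_ker !lfun_simp subr_eq0 => /eqP.
Qed.

Section Families.
Variables (V W : gvect K) (S : int -> V -> Prop) (T : int -> W -> Prop).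

(** Indexing by the total degree i + j lets a case analysis on membership
    replace the degree of a tensor by the sum of the degrees of its factors. *)
Variant pure_fam : int -> gtens V W -> Prop :=
  PureFam i j v w of S i v & T j w : pure_fam (i + j) (v ⊗ w).

Variant sum_fam (n : int) : gsum V W -> Prop :=
| SumFamL v of S n v : sum_fam n (sinl V W v)
| SumFamR w of T n w : sum_fam n (sinr V W w).

Hypotheses (VS : gspanned S) (WT : gspanned T).

Lemma gspanned_pure : gspanned pure_fam.
Proof.
move=> n X sub; apply: sumv_seq_sub => i _ _; apply: sumv_seq_sub => j _ /eqP nE.
apply: tsub_sub => v0 w0 vi wj.
apply: (spanned_bilinear (pure_bilinear _ _) (@VS i) (@WT j) _ vi wj) => v w Sv Tw.
by apply: sub; rewrite -nE; exact: PureFam.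
Qed.

Lemma gspanned_sum : gspanned sum_fam.
Proof.
move=> n X sub; rewrite subv_add; apply/andP; split.
  by apply: (spanned_img (@VS n)) => v Sv; apply/sub/SumFamL.
by apply: (spanned_img (@WT n)) => v Sv; apply/sub/SumFamR.
Qed.

End Families.

(** The definition of [gtens_gr] ranges over the supports only; outside them the
    components, hence the pure tensors, vanish. *)
Lemma mem_gtens V W i j (v : V) (w : W) :
  v \in gr V i -> w \in gr W j -> v ⊗ w \in gr (gtens V W) (i + j).
Proof.
move=> vi wj; have [si|/gr_out E] := boolP (i \in gsupp V); last first.
  by move: vi; rewrite E memv0 => /eqP ->; rewrite pure0l mem0v.
have [sj|/gr_out E] := boolP (j \in gsupp W); last first.
  by move: wj; rewrite E memv0 => /eqP ->; rewrite pure0r mem0v.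
apply: subvP (mem_tsub vi wj); apply: subv_trans (sub_sumv_seq _ si _) => //.
by apply: (sub_sumv_seq (fun j => tsub (gr V i) (gr W j)) sj).
Qed.

(** The unit object is concentrated in degree 0, so its scalars never
    contribute a Koszul sign. *)
Definition unit_fam (n : int) (c : @gone K) : Prop := n = 0.

Lemma gspanned_unit : gspanned unit_fam.
Proof.
move=> n X sub /=; rewrite /gone_gr; case: eqP => [n0|_]; last exact: sub0v.
by apply/subvP => c _; apply: sub.
Qed.

Lemma mem_gone (c : ground K) : c \in gr gone 0.
Proof. by rewrite /= /gone_gr eqxx memvf. Qed.

(** * Maps of degree zero *)

Definition deg0 V W (f : 'Hom(V, W)) : Prop := forall n, (f @: gr V n <= gr W n)%VS.

Lemma deg0_mem V W (f : 'Hom(V, W)) n v : deg0 f -> v \in gr V n -> f v \in gr W n.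
Proof. by move=> /(_ n)/subvP f0 vn; apply/f0/memv_img. Qed.

Lemma deg0_spanned V W S (f : 'Hom(V, W)) :
  gspanned S -> (forall n v, S n v -> f v \in gr W n) -> deg0 f.
Proof. by move=> VS fS n; apply: (spanned_img (@VS n)) => v /fS. Qed.

Lemma deg0_sinl V W : deg0 (sinl V W : 'Hom(V, gsum V W)).
Proof. by move=> n; exact: addvSl. Qed.
Lemma deg0_sinr V W : deg0 (sinr V W : 'Hom(W, gsum V W)).
Proof. by move=> n; exact: addvSr. Qed.

Lemma deg0_tmap V V' W W' (f : 'Hom(V, V')) (g : 'Hom(W, W')) :
  deg0 f -> deg0 g -> deg0 (tmap f g : 'Hom(gtens V W, gtens V' W')).
Proof.
move=> f0 g0; apply: (deg0_spanned (gspanned_pure (gspanned_homog V) (gspanned_homog W))).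
by move=> _ _ [i j v w vi wj]; rewrite tmap_pure; apply: mem_gtens; apply: deg0_mem.
Qed.

Lemma deg0_tassoc U V W :
  deg0 (tassoc U V W : 'Hom(gtens (gtens U V) W, gtens U (gtens V W))).
Proof.
apply: (deg0_spanned (gspanned_pure
  (gspanned_pure (gspanned_homog U) (gspanned_homog V)) (gspanned_homog W))).
move=> _ _ [_ k _ w [i j u v ui vj] wk]; rewrite tassoc_pure -addrA.
by do !apply: mem_gtens.
Qed.

Lemma deg0_tassocV U V W :
  deg0 (tassocV U V W : 'Hom(gtens U (gtens V W), gtens (gtens U V) W)).
Proof.
apply: (deg0_spanned (gspanned_pure (gspanned_homog U)
  (gspanned_pure (gspanned_homog V) (gspanned_homog W)))).
move=> _ _ [i _ u _ ui [j k v w vj wk]]; rewrite tassocV_pure addrA.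
by do !apply: mem_gtens.
Qed.

Lemma deg0_tlunit V : deg0 (tlunit V : 'Hom(gtens gone V, V)).
Proof.
apply: (deg0_spanned (gspanned_pure gspanned_unit (gspanned_homog V))).
by move=> _ _ [_ j c v -> vj]; rewrite tlunit_pure add0r memvZ.
Qed.

Lemma deg0_trunit V : deg0 (trunit V : 'Hom(gtens V gone, V)).
Proof.
apply: (deg0_spanned (gspanned_pure (gspanned_homog V) gspanned_unit)).
by move=> _ _ [i _ v c vi ->]; rewrite trunit_pure addr0 memvZ.
Qed.

Definition tlunitV (V : vectType K) : 'Hom(V, tens (ground K) V) :=
  linfun (purer V (1 : ground K)).
Definition trunitV (V : vectType K) : 'Hom(V, tens V (ground K)) :=
  linfun (purel V (1 : ground K)).
Lemma tlunitVE (V : vectType K) (v : V) : tlunitV V v = (1 : ground K) ⊗ v.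
Proof. exact: lfunE. Qed.
Lemma trunitVE (V : vectType K) (v : V) : trunitV V v = v ⊗ (1 : ground K).
Proof. exact: lfunE. Qed.

Lemma deg0_tlunitV V : deg0 (tlunitV V : 'Hom(V, gtens gone V)).
Proof.
apply: (deg0_spanned (gspanned_homog V)) => n v vn.
by rewrite tlunitVE -[n]add0r; apply: mem_gtens => //; exact: mem_gone.
Qed.
Lemma deg0_trunitV V : deg0 (trunitV V : 'Hom(V, gtens V gone)).
Proof.
apply: (deg0_spanned (gspanned_homog V)) => n v vn.
by rewrite trunitVE -[n]addr0; apply: mem_gtens => //; exact: mem_gone.
Qed.

Lemma deg0_gsum V W U (h : 'Hom(gsum V W, U)) :
  deg0 (h \o sinl V W : 'Hom(V, U))%VF -> deg0 (h \o sinr V W : 'Hom(W, U))%VF -> deg0 h.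
Proof.
move=> hl hr; apply: (deg0_spanned (gspanned_sum (gspanned_homog V) (gspanned_homog W))).
by move=> n _ [v vn|w wn]; rewrite -comp_lfunE; apply: deg0_mem; rewrite ?hl ?hr.
Qed.

Lemma deg0_comp U V W (g : 'Hom(V, W)) (f : 'Hom(U, V)) :
  deg0 g -> deg0 f -> deg0 (g \o f)%VF.
Proof. by move=> g0 f0 n; rewrite limg_comp; apply: subv_trans (limgS _ (f0 n)) (g0 n). Qed.

Lemma deg0_id V : deg0 (\1%VF : 'End(V)).
Proof. by move=> n; rewrite lim1g. Qed.

Lemma deg0_0 V W : deg0 (0 : 'Hom(V, W)).
Proof. by move=> n; rewrite lim0g sub0v. Qed.

Lemma deg0_pr14 A A' B B' :
  deg0 (pr14 A A' B B' : 'Hom(gtens (gsum A A') (gsum B B'), gsum (gtens A B) (gtens A' B'))).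
Proof.
apply: (deg0_spanned (gspanned_pure
  (gspanned_sum (gspanned_homog A) (gspanned_homog A'))
  (gspanned_sum (gspanned_homog B) (gspanned_homog B')))).
move=> _ _ [i j _ _ [a ai|a' ai] [b bj|b' bj]];
  rewrite ?pr14_ll ?pr14_lr ?pr14_rl ?pr14_rr ?mem0v //.
- exact: (deg0_mem (V := gtens A B) (@deg0_sinl _ (gtens A' B')) (mem_gtens ai bj)).
- exact: (deg0_mem (V := gtens A' B') (@deg0_sinr (gtens A B) _) (mem_gtens ai bj)).
Qed.

(** * The middle exchange *)

(** Only the two middle factors are exchanged, so only the maps on these have to
    preserve the degrees that enter the sign. *)
Lemma S23_nat A1 A2 B1 B2 A1' A2' B1' B2'
    (f1 : 'Hom(A1, A1')) (f2 : 'Hom(A2, A2')) (g1 : 'Hom(B1, B1')) (g2 : 'Hom(B2, B2')) :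
  deg0 f2 -> deg0 g1 ->
  (S23 A1' A2' B1' B2' \o tmap (tmap f1 f2) (tmap g1 g2)
   = tmap (tmap f1 g1) (tmap f2 g2) \o S23 A1 A2 B1 B2)%VF.
Proof.
move=> f0 g0; apply: (gspanned_ext (V := gtens (gtens A1 A2) (gtens B1 B2)) (gspanned_pure
  (gspanned_pure (gspanned_homog A1) (gspanned_homog A2))
  (gspanned_pure (gspanned_homog B1) (gspanned_homog B2)))).
move=> _ _ [_ _ _ _ [i j a a' ai aj] [k l b b' bk bl]].
rewrite !comp_lfunE (S23_pure _ _ aj bk) linearZ /= !tmap_pure.
by rewrite (S23_pure _ _ (deg0_mem f0 aj) (deg0_mem g0 bk)).
Qed.

Lemma expN1D (i j : int) : (-1) ^ (i + j) = (-1) ^ i * (-1) ^ j :> K.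
Proof. by apply: expfzDr; rewrite oppr_eq0 oner_neq0. Qed.

(** Coherence of the exchange with the associator: with the factors
    a, a', b, b', c, c' in this order, both sides have the sign exponent
    |a'||b| + |a'||c| + |b'||c|.  It makes the associator of the tensor product
    preserve the relations of an iterated bullet product. *)
Lemma S23_assoc A A' B B' C C' :
  (tmap (tassoc A B C) (tassoc A' B' C') \o S23 (gtens A B) (gtens A' B') C C'
     \o tmap (S23 A A' B B') \1
   = S23 A A' (gtens B C) (gtens B' C') \o tmap \1 (S23 B B' C C')
     \o tassoc (gtens A A') (gtens B B') (gtens C C'))%VF.
Proof.
apply: (gspanned_ext (V := gtens (gtens (gtens A A') (gtens B B')) (gtens C C'))
  (gspanned_pure (gspanned_pure
    (gspanned_pure (gspanned_homog A) (gspanned_homog A'))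
    (gspanned_pure (gspanned_homog B) (gspanned_homog B')))
    (gspanned_pure (gspanned_homog C) (gspanned_homog C')))).
move=> _ _ [_ _ _ _ [_ _ _ _ [i i' a a' ai ai'] [j j' b b' bj bj']] [k k' c c' ck ck']].
rewrite !comp_lfunE tassoc_pure !tmap_pure !id_lfunE.
rewrite (S23_pure _ _ ai' bj) (S23_pure _ _ bj' ck) pureZl pureZr !linearZ /=.
have /= -> := S23_pure (a ⊗ b : gtens A B) c' (mem_gtens ai' bj') ck.
have /= -> := S23_pure a (b' ⊗ c' : gtens B' C') ai' (mem_gtens bj ck).
rewrite linearZ /= tmap_pure !tassoc_pure !scalerA -!expN1D.
by congr (_ ^ _ *: _); rewrite mulrDl mulrDr [RHS]addrC addrA.
Qed.

Lemma tassocK U V W :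
  (tassocV U V W \o tassoc U V W = \1%VF :> 'End(gtens (gtens U V) W))%VF.
Proof.
apply: (gspanned_ext (gspanned_pure
  (gspanned_pure (gspanned_homog U) (gspanned_homog V)) (gspanned_homog W))).
move=> _ _ [_ k _ w [i j u v _ _] _].
by rewrite comp_lfunE id_lfunE tassoc_pure tassocV_pure.
Qed.

Lemma tassocVK U V W :
  (tassoc U V W \o tassocV U V W = \1%VF :> 'End(gtens U (gtens V W)))%VF.
Proof.
apply: (gspanned_ext (gspanned_pure (gspanned_homog U)
  (gspanned_pure (gspanned_homog V) (gspanned_homog W)))).
move=> _ _ [i _ u _ _ [j k v w _ _]].
by rewrite comp_lfunE id_lfunE tassocV_pure tassoc_pure.
Qed.

Lemma S23_assocE A A' B B' C C' (x : tens A A') (y : tens B B') (z : tens C C') :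
  tmap (tassoc A B C) (tassoc A' B' C')
    (S23 (gtens A B) (gtens A' B') C C' (S23 A A' B B' (x ⊗ y) ⊗ z))
  = S23 A A' (gtens B C) (gtens B' C') (x ⊗ S23 B B' C C' (y ⊗ z)).
Proof.
have /lfunP/(_ ((x ⊗ y) ⊗ z)) := S23_assoc A A' B B' C C'.
by rewrite !comp_lfunE tassoc_pure !tmap_pure !id_lfunE.
Qed.

Lemma S23_assocVE A A' B B' C C' (x : tens A A') (y : tens B B') (z : tens C C') :
  tmap (tassocV A B C) (tassocV A' B' C')
    (S23 A A' (gtens B C) (gtens B' C') (x ⊗ S23 B B' C C' (y ⊗ z)))
  = S23 (gtens A B) (gtens A' B') C C' (S23 A A' B B' (x ⊗ y) ⊗ z).
Proof. by rewrite -S23_assocE -comp_lfunE -tmap_comp !tassocK tmap_id id_lfunE. Qed.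

(** The product of the ground field, [tlunit (ground K)], turns the first
    argument into a single scalar: the unitor maps the relations of the product
    with the unit to multiples of the given ones. *)
Lemma S23_lunit A A' x y :
  tmap (tlunit A) (tlunit A') (S23 gone gone A A' (x ⊗ y))
  = tlunit (tens A A') (tlunit (ground K) x ⊗ y).
Proof.
suff /lfunP/(_ (x ⊗ y)) : (tmap (tlunit A) (tlunit A') \o S23 gone gone A A'
    = tlunit (gtens A A') \o tmap (tlunit gone) \1)%VF.
  by rewrite !comp_lfunE tmap_pure id_lfunE.
apply: (gspanned_ext (V := gtens (gtens gone gone) (gtens A A')) (gspanned_pure
  (gspanned_pure gspanned_unit gspanned_unit)
  (gspanned_pure (gspanned_homog A) (gspanned_homog A')))).
move=> _ _ [_ _ _ _ [_ _ c d _ _] [i j a a' ai _]].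
rewrite !comp_lfunE (S23_pure _ _ (mem_gone d) ai) mul0r expr0z scale1r.
rewrite !tmap_pure !tlunit_pure id_lfunE.
by rewrite pureZl pureZr scalerA.
Qed.

Lemma S23_runit A A' x y :
  tmap (trunit A) (trunit A') (S23 A A' gone gone (y ⊗ x))
  = trunit (tens A A') (y ⊗ tlunit (ground K) x).
Proof.
suff /lfunP/(_ (y ⊗ x)) : (tmap (trunit A) (trunit A') \o S23 A A' gone gone
    = trunit (gtens A A') \o tmap \1 (tlunit gone))%VF.
  by rewrite !comp_lfunE tmap_pure id_lfunE.
apply: (gspanned_ext (V := gtens (gtens A A') (gtens gone gone)) (gspanned_pure
  (gspanned_pure (gspanned_homog A) (gspanned_homog A'))
  (gspanned_pure gspanned_unit gspanned_unit))).
move=> _ _ [_ _ _ _ [i j a a' _ aj] [_ _ c d _ _]].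
rewrite !comp_lfunE (S23_pure _ _ aj (mem_gone c)) mulr0 expr0z scale1r.
rewrite !tmap_pure !trunit_pure tlunit_pure id_lfunE.
by rewrite pureZl pureZr scalerA.
Qed.

Lemma S23_lunitV A A' :
  (tmap (tlunitV A) (tlunitV A')
   = S23 gone gone A A' \o linfun (purer (tens A A') ((1 : ground K) ⊗ (1 : ground K))))%VF.
Proof.
apply: (gspanned_ext (V := gtens A A') (gspanned_pure (gspanned_homog A) (gspanned_homog A'))).
move=> _ _ [i j a a' ai _]; rewrite comp_lfunE lfunE /= tmap_pure !tlunitVE.
have /= -> := S23_pure (A := gone) (1 : ground K) a' (mem_gone 1) ai.
by rewrite mul0r expr0z scale1r.
Qed.

Lemma S23_runitV A A' :
  (tmap (trunitV A) (trunitV A')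
   = S23 A A' gone gone \o linfun (purel (tens A A') ((1 : ground K) ⊗ (1 : ground K))))%VF.
Proof.
apply: (gspanned_ext (V := gtens A A') (gspanned_pure (gspanned_homog A) (gspanned_homog A'))).
move=> _ _ [i j a a' _ aj]; rewrite comp_lfunE lfunE /= tmap_pure !trunitVE.
have /= -> := S23_pure (B' := gone) a (1 : ground K) aj (mem_gone 1).
by rewrite mulr0 expr0z scale1r.
Qed.

(** * Graded anticommutators *)

Lemma expN1K (i : int) : (-1) ^ i * (-1) ^ i = 1 :> K.
Proof. by rewrite -expfzMl ?mulrNN ?mul1r ?exp1rz. Qed.

(** For x and y homogeneous and s the product of their degrees, this is the
    generator of [bracket_plus]. *)
Definition acomm (V : vectType K) (s : int) (x y : V) : tens V V :=
  x ⊗ y + (-1) ^ s *: (y ⊗ x).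

Lemma acomm_bilinear (V : vectType K) s : bilinear_for *:%R *:%R (@acomm V s).
Proof.
split=> [y c x z|y c x z] /=;
  rewrite /acomm !(pureDl, pureDr, pureZl, pureZr) !scalerDr !scalerA [_ * c]mulrC !addrA;
  by congr (_ + _); rewrite addrAC.
Qed.

Lemma acomm_sum_bilinear A B s :
  bilinear_for *:%R *:%R (fun (a : A) (b : B) => acomm s (sinl A B a) (sinr A B b)).
Proof.
have [bl br] := acomm_bilinear (dsum A B) s.
by split=> [y c x z|y c x z] /=; rewrite linearP ?bl ?br.
Qed.

Lemma tmap_acomm (V W : vectType K) (f : 'Hom(V, W)) s x y :
  tmap f f (acomm s x y) = acomm s (f x) (f y).
Proof. by rewrite linearD linearZ /= !tmap_pure. Qed.

Lemma mem_bracket A B i j (a : A) (b : B) :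
  a \in gr A i -> b \in gr B j ->
  acomm (i * j) (sinl A B a) (sinr A B b) \in bracket_plus A B.
Proof.
move=> ai bj.
have [si|/gr_out E] := boolP (i \in gsupp A); last first.
  by move: ai; rewrite E memv0 => /eqP ->; rewrite /acomm linear0 pure0l pure0r scaler0 addr0 mem0v.
have [sj|/gr_out E] := boolP (j \in gsupp B); last first.
  by move: bj; rewrite E memv0 => /eqP ->; rewrite /acomm linear0 pure0l pure0r scaler0 addr0 mem0v.
pose D k l := <<[seq (sinl A B x ⊗ sinr A B y + (-1) ^ (k * l) *: (sinr A B y ⊗ sinl A B x))%R
  | x <- vbasis (gr A k), y <- vbasis (gr B l)]>>%VS.
suff : acomm (i * j) (sinl A B a) (sinr A B b) \in D i j.
  apply/subvP; refine (subv_trans (sub_sumv_seq (D i) sj (P := xpredT) isT) _).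
  exact: (sub_sumv_seq (fun k => \sum_(l <- gsupp B) D k l)%VS si).
have sp (V : gvect K) n : spanned (gr V n) (fun v => v \in vbasis (gr V n)).
  move=> X sub; rewrite -(span_basis (vbasisP (gr V n))); apply/span_subvP => v; exact: sub.
apply: (spanned_bilinear (acomm_sum_bilinear A B (i * j)) (@sp A i) (@sp B j)) => // v w vA wB.
by apply: memv_span; apply/allpairsP; exists (v, w).
Qed.

(** Bilinearity allows generators from any spanning families; with those of
    [gspanned_sum] the bracket of a direct sum with C splits into two brackets. *)
Lemma bracket_le A B S T (X : {vspace tens (gsum A B) (gsum A B)}) :
    gspanned S -> gspanned T ->
    (forall i j (a : A) (b : B), S i a -> T j b ->
      acomm (i * j) (sinl A B a) (sinr A B b) \in X) ->
  (bracket_plus A B <= X)%VS.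
Proof.
move=> AS BT sub; apply: sumv_seq_sub => i _ _; apply: sumv_seq_sub => j _ _.
apply/span_subvP => _ /allpairsP[[a b] [/= /vbasis_mem ai /vbasis_mem bj ->]].
by apply: (spanned_bilinear (acomm_sum_bilinear A B (i * j)) (AS i) (BT j)) => // u v; exact: sub.
Qed.

End GradedSpanning.

Arguments gspanned_homog {K} V n X.

(** * Relations of the two products *)

Section Relations.
Variable K : fieldType.
Implicit Types A B C : QD K.

Lemma mem_bullet A B r s : r \in qrel A -> s \in qrel B ->
  S23 (qgen A) (qgen A) (qgen B) (qgen B) (r ⊗ s) \in qrel (bullet A B).
Proof. by move=> rA sB; apply/memv_img/mem_tsub. Qed.

Variant bullet_gen A B (S : tens (qgen A) (qgen A) -> Prop)
    (T : tens (qgen B) (qgen B) -> Prop) : tens (qgen (bullet A B)) (qgen (bullet A B)) -> Prop :=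
  BulletGen r s of S r & T s :
    bullet_gen S T (S23 (qgen A) (qgen A) (qgen B) (qgen B) (r ⊗ s)).

Lemma spanned_bullet A B S T : spanned (qrel A) S -> spanned (qrel B) T ->
  spanned (qrel (bullet A B)) (bullet_gen S T).
Proof.
move=> AS BT X sub; apply/subvP => _ /memv_imgP[x xAB ->].
rewrite memv_preim; apply: subvP xAB; apply: tsub_sub => r s.
apply: (spanned_bilinear (pure_bilinear _ _) AS BT) => {}r {}s Sr Ts.
by rewrite -memv_preim; apply/sub/BulletGen.
Qed.

Lemma spanned_qrel A : spanned (qrel A) (fun r => r \in qrel A).
Proof. by move=> X sub; apply/subvP. Qed.
Arguments spanned_qrel : clear implicits.

Section UtenRelations.
Variables A B : QD K.
Local Notation inl := (sinl (qgen A) (qgen B)).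
Local Notation inr := (sinr (qgen A) (qgen B)).

Lemma mem_uten_l r : r \in qrel A -> tmap inl inl r \in qrel (uten A B).
Proof.
by move=> rA; apply: subvP (memv_img _ rA); apply: subv_trans (addvSl _ _); apply: addvSl.
Qed.

Lemma mem_uten_r s : s \in qrel B -> tmap inr inr s \in qrel (uten A B).
Proof. by move=> sB; apply: subvP (memv_img _ sB); apply: addvSr. Qed.

Lemma mem_uten_acomm i j (a : qgen A) (b : qgen B) : a \in gr _ i -> b \in gr _ j ->
  acomm (i * j) (inl a) (inr b) \in qrel (uten A B).
Proof.
move=> ai bj; apply: subvP (mem_bracket ai bj).
by apply: subv_trans (addvSl _ _); apply: addvSr.
Qed.

Variant uten_gen (S : int -> qgen A -> Prop) (T : int -> qgen B -> Prop) :
    tens (dsum (qgen A) (qgen B)) (dsum (qgen A) (qgen B)) -> Prop :=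
| UtenL r of r \in qrel A : uten_gen S T (tmap inl inl r)
| UtenM i j a b of S i a & T j b : uten_gen S T (acomm (i * j) (inl a) (inr b))
| UtenR s of s \in qrel B : uten_gen S T (tmap inr inr s).

Lemma spanned_uten S T : gspanned S -> gspanned T ->
  spanned (qrel (uten A B)) (uten_gen S T).
Proof.
move=> AS BT X sub; rewrite !subv_add; apply/andP; split; first (apply/andP; split).
- by apply/subvP => _ /memv_imgP[r rA ->]; apply/sub/UtenL.
- by apply: (bracket_le AS BT) => i j a b Sa Tb; apply/sub/UtenM.
- by apply/subvP => _ /memv_imgP[r rA ->]; apply/sub/UtenR.
Qed.

(** A map out of the direct sum is controlled by its restrictions to the two
    summands and by the anticommutators between them.  As the conclusion has the
    form of the first two hypotheses, the lemma can be iterated along nested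
    sums. *)
Lemma uten_rel_ind (W : vectType K) (h : 'Hom(dsum (qgen A) (qgen B), W)) S T
    (X : {vspace tens W W}) :
    gspanned S -> gspanned T ->
    (forall r, r \in qrel A -> tmap (h \o inl)%VF (h \o inl)%VF r \in X) ->
    (forall s, s \in qrel B -> tmap (h \o inr)%VF (h \o inr)%VF s \in X) ->
    (forall i j a b, S i a -> T j b -> acomm (i * j) (h (inl a)) (h (inr b)) \in X) ->
  forall r, r \in qrel (uten A B) -> tmap h h r \in X.
Proof.
move=> AS BT hA hB hAB; apply/(limg_subP (tmap h h)); apply: (spanned_img (spanned_uten AS BT)).
move=> _ [r rA|i j a b Sa Tb|s sB].
- by rewrite -comp_lfunE -tmap_comp; apply: hA.
- by rewrite tmap_acomm; apply: hAB.
- by rewrite -comp_lfunE -tmap_comp; apply: hB.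
Qed.

End UtenRelations.

Lemma qd_rel_mem A B (f : qd_mor A B) r : r \in qrel A -> tmap (qd_map f) (qd_map f) r \in qrel B.
Proof. by move=> rA; apply: (subvP (qd_rel f)); apply: memv_img. Qed.

(** * The interchange map *)

Section Interchange.
Variables A A' B B' : QD K.
Local Notation pr := (pr14 (qgen A) (qgen A') (qgen B) (qgen B')).
Local Notation iA := (sinl (qgen A) (qgen A')).
Local Notation iA' := (sinr (qgen A) (qgen A')).
Local Notation iB := (sinl (qgen B) (qgen B')).
Local Notation iB' := (sinr (qgen B) (qgen B')).

Let pr_ll : (pr \o tmap iA iB)%VF = sinl _ _.
Proof. by apply: tens_ext => a b; rewrite comp_lfunE tmap_pure pr14_ll. Qed.
Let pr_lr : (pr \o tmap iA iB')%VF = 0.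
Proof. by apply: tens_ext => a b; rewrite comp_lfunE tmap_pure pr14_lr lfunE. Qed.
Let pr_rl : (pr \o tmap iA' iB)%VF = 0.
Proof. by apply: tens_ext => a b; rewrite comp_lfunE tmap_pure pr14_rl lfunE. Qed.
Let pr_rr : (pr \o tmap iA' iB')%VF = sinr _ _.
Proof. by apply: tens_ext => a b; rewrite comp_lfunE tmap_pure pr14_rr. Qed.

Let Phi r s := tmap pr pr (S23 (qgen (uten A A')) (qgen (uten A A'))
  (qgen (uten B B')) (qgen (uten B B')) (r ⊗ s)).

(** By naturality of the exchange, the summand inclusions f1, f2, g1, g2 meet
    the projection in the pairs (f1, g1) and (f2, g2), and it kills every pair
    of inclusions of different index. *)
Let PhiE (V1 V2 W1 W2 : gvect K)
    (f1 : 'Hom(V1, gsum (qgen A) (qgen A'))) (f2 : 'Hom(V2, gsum (qgen A) (qgen A')))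
    (g1 : 'Hom(W1, gsum (qgen B) (qgen B'))) (g2 : 'Hom(W2, gsum (qgen B) (qgen B'))) r s :
  deg0 f2 -> deg0 g1 ->
  Phi (tmap f1 f2 r) (tmap g1 g2 s)
  = tmap (pr \o tmap f1 g1)%VF (pr \o tmap f2 g2)%VF (S23 V1 V2 W1 W2 (r ⊗ s)).
Proof.
move=> f0 g0; rewrite tmap_comp comp_lfunE; congr (tmap _ _ _).
have /lfunP/(_ (r ⊗ s)) := S23_nat f1 g2 f0 g0.
by rewrite !comp_lfunE tmap_pure.
Qed.

Let acommE (V W : vectType K) s v w : acomm s (sinl V W v) (sinr V W w)
  = tmap (sinl V W) (sinr V W) (v ⊗ w) + (-1) ^ s *: tmap (sinr V W) (sinl V W) (w ⊗ v).
Proof. by rewrite !tmap_pure. Qed.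

(** Each side has three kinds of relations, those of the two summands and the
    anticommutators, which gives nine products.  Writing all of them as images
    under inclusions, [PhiE] kills the six products of different kinds, sends the
    two products of summand relations into the relations of the corresponding
    bullet product, and leaves two of the four terms of a product of
    anticommutators; these two form an anticommutator. *)
Lemma pr14_rel :
  (tmap pr pr @: qrel (bullet (uten A A') (uten B B'))
   <= qrel (uten (bullet A B) (bullet A' B')))%VS.
Proof.
pose sp := @gspanned_homog K.
apply: (spanned_img (spanned_bullet (spanned_uten (sp _) (sp _)) (spanned_uten (sp _) (sp _)))).
move=> _ [r s rA sB]; rewrite -/(Phi r s).
have sl := @deg0_sinl K; have sr := @deg0_sinr K.
have PD1 x y z : Phi (x + y) z = Phi x z + Phi y z.
  by rewrite /Phi pureDl !linearD.
have PD2 x y z : Phi x (y + z) = Phi x y + Phi x z.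
  by rewrite /Phi pureDr !linearD.
have PZ1 c x z : Phi (c *: x) z = c *: Phi x z.
  by rewrite /Phi pureZl !linearZ.
have PZ2 c x z : Phi x (c *: z) = c *: Phi x z.
  by rewrite /Phi pureZr !linearZ.
pose simp := (acommE, PD1, PD2, PZ1, PZ2, PhiE _ _ _ _ (sl _ _) (sl _ _),
  PhiE _ _ _ _ (sl _ _) (sr _ _), PhiE _ _ _ _ (sr _ _) (sl _ _), PhiE _ _ _ _ (sr _ _) (sr _ _),
  pr_ll, pr_lr, pr_rl, pr_rr, tmap0l, tmap0r).
case: rA sB => [{}r rA|i i' a a' ai ai'|{}r rA'] [{}s sB|j j' b b' bj bj'|{}s sB'];
  rewrite !simp ?zero_lfunE ?scaler0 ?addr0 ?mem0v //.
- exact: (mem_uten_l (A := bullet A B) (bullet A' B') (mem_bullet rA sB)).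
- rewrite add0r (S23_pure _ _ ai' bj) (S23_pure _ _ ai bj') !linearZ /= !tmap_pure.
  rewrite !scalerA -!expN1D.
  (* the two exponents differ by twice i' * j *)
  have -> : (-1) ^ (j * j' + i * j' + i * i')
      = (-1) ^ (i' * j) * (-1) ^ ((i + j) * (i' + j')) :> K.
    rewrite !(mulrDl, mulrDr) !expN1D [j * i']mulrC.
    rewrite [RHS](_ : _ = ((-1) ^ (i' * j) * (-1) ^ (i' * j))
      * ((-1) ^ (i * i') * (-1) ^ (j * j') * (-1) ^ (i * j'))).
      by rewrite expN1K; ring.
    by ring.
  rewrite -scalerA -scalerDr memvZ //.
  exact: (mem_uten_acomm (A := bullet A B) (B := bullet A' B')
    (mem_gtens ai bj) (mem_gtens ai' bj')).
- exact: (mem_uten_r (bullet A B) (B := bullet A' B') (mem_bullet rA' sB')).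
Qed.

End Interchange.

End Relations.

Arguments spanned_qrel {K} A X.

(** * The bullet product is monoidal *)

Section BulletMonoidal.
Variable K : fieldType.
Implicit Types A B C : QD K.

Program Definition bullet_mor A A' B B' (f : mor A A') (g : mor B B') :
    mor (bullet A B) (bullet A' B') :=
  @QdMor K (bullet A B) (bullet A' B') (tmap (qd_map f) (qd_map g)) _ _.
Next Obligation. by move=> A A' B B' f g; apply: deg0_tmap; apply: qd_deg0. Qed.
Next Obligation.
move=> A A' B B' f g.
apply: (spanned_img (spanned_bullet (spanned_qrel A) (spanned_qrel B))).
move=> _ [r s rA sB].
have /lfunP/(_ (r ⊗ s)) :=
  S23_nat (qd_map f) (qd_map g) (qd_deg0 f) (qd_deg0 g).
rewrite !comp_lfunE tmap_pure => <-.
exact: (mem_bullet (A := A') (B := B') (qd_rel_mem f rA) (qd_rel_mem g sB)).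
Qed.

Program Definition bullet_assoc A B C :
    mor (bullet (bullet A B) C) (bullet A (bullet B C)) :=
  @QdMor K (bullet (bullet A B) C) (bullet A (bullet B C))
    (tassoc (qgen A) (qgen B) (qgen C)) _ _.
Next Obligation. by move=> *; apply: deg0_tassoc. Qed.
Next Obligation.
move=> A B C.
apply: (spanned_img (spanned_bullet (spanned_bullet
  (spanned_qrel A) (spanned_qrel B)) (spanned_qrel C))).
move=> _ [_ t [r s rA sB] tC]; have /= -> := S23_assocE r s t.
exact: (mem_bullet (B := bullet B C) rA (mem_bullet sB tC)).
Qed.

Program Definition bullet_assocV A B C :
    mor (bullet A (bullet B C)) (bullet (bullet A B) C) :=
  @QdMor K (bullet A (bullet B C)) (bullet (bullet A B) C)
    (tassocV (qgen A) (qgen B) (qgen C)) _ _.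
Next Obligation. by move=> *; apply: deg0_tassocV. Qed.
Next Obligation.
move=> A B C.
apply: (spanned_img (spanned_bullet (spanned_qrel A) (spanned_bullet
  (spanned_qrel B) (spanned_qrel C)))).
move=> _ [r _ rA [s t sB tC]]; have /= -> := S23_assocVE r s t.
exact: (mem_bullet (A := bullet A B) (mem_bullet rA sB) tC).
Qed.

Program Definition bullet_lunit A : mor (bullet (bullet_unit K) A) A :=
  @QdMor K (bullet (bullet_unit K) A) A (tlunit (qgen A)) _ _.
Next Obligation. by move=> *; apply: deg0_tlunit. Qed.
Next Obligation.
move=> A; apply: (spanned_img (spanned_bullet (spanned_qrel (bullet_unit K)) (spanned_qrel A))).
by move=> _ [c r _ rA]; have /= -> := S23_lunit c r; rewrite tlunit_pure memvZ.
Qed.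

Program Definition bullet_lunitV A : mor A (bullet (bullet_unit K) A) :=
  @QdMor K A (bullet (bullet_unit K) A) (tlunitV (qgen A)) _ _.
Next Obligation. by move=> *; apply: deg0_tlunitV. Qed.
Next Obligation.
move=> A; apply/limg_subP => r rA; rewrite S23_lunitV comp_lfunE lfunE.
exact: (mem_bullet (A := bullet_unit K) (memvf _) rA).
Qed.

Program Definition bullet_runit A : mor (bullet A (bullet_unit K)) A :=
  @QdMor K (bullet A (bullet_unit K)) A (trunit (qgen A)) _ _.
Next Obligation. by move=> *; apply: deg0_trunit. Qed.
Next Obligation.
move=> A; apply: (spanned_img (spanned_bullet (spanned_qrel A) (spanned_qrel (bullet_unit K)))).
by move=> _ [r c rA _]; have /= -> := S23_runit c r; rewrite trunit_pure memvZ.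
Qed.

Program Definition bullet_runitV A : mor A (bullet A (bullet_unit K)) :=
  @QdMor K A (bullet A (bullet_unit K)) (trunitV (qgen A)) _ _.
Next Obligation. by move=> *; apply: deg0_trunitV. Qed.
Next Obligation.
move=> A; apply/limg_subP => r rA; rewrite S23_runitV comp_lfunE lfunE.
exact: (mem_bullet (B := bullet_unit K) rA (memvf _)).
Qed.

Program Definition bullet_monoidal : monoidal (@bullet K) (bullet_unit K) := {|
  tenm := bullet_mor;
  assoc := bullet_assoc;
  assocV := bullet_assocV;
  lunit := bullet_lunit;
  lunitV := bullet_lunitV;
  runit := bullet_runit;
  runitV := bullet_runitV |}.
Next Obligation. by move=> A B; apply: qd_mor_inj; apply: tmap_id. Qed.
Next Obligation. by move=> *; apply: qd_mor_inj; apply: tmap_comp. Qed.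
Next Obligation. by move=> A B C; apply: qd_mor_inj; apply: tassocK. Qed.
Next Obligation. by move=> A B C; apply: qd_mor_inj; apply: tassocVK. Qed.
Next Obligation.
move=> A A' B B' C C' f g h; apply: qd_mor_inj.
apply: (gspanned_ext (V := qgen (bullet (bullet A B) C))
  (gspanned_pure (gspanned_pure (gspanned_homog _) (gspanned_homog _)) (gspanned_homog _))).
move=> _ _ [_ _ _ c [_ _ a b _ _] _].
by rewrite /= !comp_lfunE !(tmap_pure, tassoc_pure).
Qed.
Next Obligation.
move=> A; apply: qd_mor_inj.
apply: (gspanned_ext (V := qgen (bullet (bullet_unit K) A))
  (gspanned_pure (gspanned_homog _) (gspanned_homog _))).
move=> _ _ [_ _ c a _ _]; rewrite /= comp_lfunE id_lfunE tlunit_pure tlunitVE.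
by rewrite pureZr -pureZl [_ *: _]mulr1.
Qed.
Next Obligation.
move=> A; apply: qd_mor_inj; apply/lfunP => a.
by rewrite /= comp_lfunE id_lfunE tlunitVE tlunit_pure scale1r.
Qed.
Next Obligation.
move=> A A' f; apply: qd_mor_inj; apply: tens_ext => c a.
by rewrite /= !comp_lfunE tmap_pure !tlunit_pure id_lfunE linearZ.
Qed.
Next Obligation.
move=> A; apply: qd_mor_inj.
apply: (gspanned_ext (V := qgen (bullet A (bullet_unit K)))
  (gspanned_pure (gspanned_homog _) (gspanned_homog _))).
move=> _ _ [_ _ a c _ _]; rewrite /= comp_lfunE id_lfunE trunit_pure trunitVE.
by rewrite pureZl -pureZr [_ *: _]mulr1.
Qed.
Next Obligation.
move=> A; apply: qd_mor_inj; apply/lfunP => a.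
by rewrite /= comp_lfunE id_lfunE trunitVE trunit_pure scale1r.
Qed.
Next Obligation.
move=> A A' f; apply: qd_mor_inj; apply: tens_ext => a c.
by rewrite /= !comp_lfunE tmap_pure !trunit_pure id_lfunE linearZ.
Qed.
Next Obligation.
move=> A B C D; apply: qd_mor_inj.
apply: (gspanned_ext (V := qgen (bullet (bullet (bullet A B) C) D))
  (gspanned_pure (gspanned_pure (gspanned_pure
    (gspanned_homog _) (gspanned_homog _)) (gspanned_homog _)) (gspanned_homog _))).
move=> _ _ [_ _ _ d [_ _ _ c [_ _ a b _ _] _] _].
rewrite /= !comp_lfunE !tmap_pure !tassoc_pure.
by rewrite tmap_pure tassoc_pure !id_lfunE.
Qed.
Next Obligation.
move=> A B; apply: qd_mor_inj.
apply: (gspanned_ext (V := qgen (bullet (bullet A (bullet_unit K)) B))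
  (gspanned_pure (gspanned_pure (gspanned_homog _) (gspanned_homog _)) (gspanned_homog _))).
move=> _ _ [_ _ _ b [_ _ a c _ _] _].
rewrite /= !comp_lfunE tassoc_pure !tmap_pure !id_lfunE tlunit_pure trunit_pure.
by rewrite pureZl pureZr.
Qed.

Lemma bullet_monoidalP : bullet_structure bullet_monoidal.
Proof. by split. Qed.

End BulletMonoidal.

(** * The direct sum product is monoidal *)

Section DirectSumMaps.
Variable K : fieldType.

Lemma smap_sinl (V V' W W' : vectType K) (f : 'Hom(V, V')) (g : 'Hom(W, W')) :
  (smap f g \o sinl V W = sinl V' W' \o f)%VF.
Proof. by apply/lfunP => v; rewrite !comp_lfunE smapE !sinlE /= linear0. Qed.

Lemma smap_sinr (V V' W W' : vectType K) (f : 'Hom(V, V')) (g : 'Hom(W, W')) :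
  (smap f g \o sinr V W = sinr V' W' \o g)%VF.
Proof. by apply/lfunP => v; rewrite !comp_lfunE smapE !sinrE /= linear0. Qed.

Section Assoc.
Variables U V W : vectType K.

Lemma sassoc_sinll :
  ((sassoc U V W \o sinl (dsum U V) W) \o sinl U V = sinl U (dsum V W))%VF.
Proof. by apply/lfunP => x; rewrite !comp_lfunE sassocE !sinlE. Qed.
Lemma sassoc_sinlr :
  ((sassoc U V W \o sinl (dsum U V) W) \o sinr U V = sinr U (dsum V W) \o sinl V W)%VF.
Proof. by apply/lfunP => x; rewrite !comp_lfunE sassocE ?(sinlE, sinrE). Qed.
Lemma sassoc_sinr :
  (sassoc U V W \o sinr (dsum U V) W = sinr U (dsum V W) \o sinr V W)%VF.
Proof. by apply/lfunP => x; rewrite !comp_lfunE sassocE ?(sinlE, sinrE). Qed.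

Lemma sassocV_sinl :
  (sassocV U V W \o sinl U (dsum V W) = sinl (dsum U V) W \o sinl U V)%VF.
Proof. by apply/lfunP => x; rewrite !comp_lfunE sassocVE ?(sinlE, sinrE). Qed.
Lemma sassocV_sinrl :
  ((sassocV U V W \o sinr U (dsum V W)) \o sinl V W = sinl (dsum U V) W \o sinr U V)%VF.
Proof. by apply/lfunP => x; rewrite !comp_lfunE sassocVE ?(sinlE, sinrE). Qed.
Lemma sassocV_sinrr :
  ((sassocV U V W \o sinr U (dsum V W)) \o sinr V W = sinr (dsum U V) W)%VF.
Proof. by apply/lfunP => x; rewrite !comp_lfunE sassocVE ?(sinlE, sinrE). Qed.

End Assoc.

Lemma nullv_eq0 (x : nullv K) : x = 0.
Proof. exact: thinmx0. Qed.

Lemma slunit_sinl (V : vectType K) : (slunit V \o sinl (nullv K) V)%VF = 0.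
Proof. by apply/lfunP => x; rewrite comp_lfunE slunitE sinlE lfunE. Qed.
Lemma slunit_sinr (V : vectType K) : (slunit V \o sinr (nullv K) V)%VF = \1%VF.
Proof. by apply/lfunP => x; rewrite comp_lfunE slunitE sinrE id_lfunE. Qed.
Lemma srunit_sinl (V : vectType K) : (srunit V \o sinl V (nullv K))%VF = \1%VF.
Proof. by apply/lfunP => x; rewrite comp_lfunE srunitE sinlE id_lfunE. Qed.
Lemma srunit_sinr (V : vectType K) : (srunit V \o sinr V (nullv K))%VF = 0.
Proof. by apply/lfunP => x; rewrite comp_lfunE srunitE sinrE lfunE. Qed.

End DirectSumMaps.

Section UtenMonoidal.
Variable K : fieldType.
Implicit Types A B C : QD K.

Program Definition uten_mor A A' B B' (f : mor A A') (g : mor B B') :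
    mor (uten A B) (uten A' B') :=
  @QdMor K (uten A B) (uten A' B') (smap (qd_map f) (qd_map g)) _ _.
Next Obligation.
move=> A A' B B' f g; apply: deg0_gsum; rewrite ?smap_sinl ?smap_sinr.
  exact: deg0_comp (@deg0_sinl _ _ _) (qd_deg0 f).
exact: deg0_comp (@deg0_sinr _ _ _) (qd_deg0 g).
Qed.
Next Obligation.
move=> A A' B B' f g; apply/limg_subP.
apply: (uten_rel_ind (A := A) (B := B) (gspanned_homog _) (gspanned_homog _)).
- move=> r rA; rewrite smap_sinl tmap_comp comp_lfunE.
  exact: (mem_uten_l _ (qd_rel_mem f rA)).
- move=> r rB; rewrite smap_sinr tmap_comp comp_lfunE.
  exact: (mem_uten_r _ (qd_rel_mem g rB)).
move=> i j a b ai bj; rewrite -!comp_lfunE smap_sinl smap_sinr !comp_lfunE.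
exact: (mem_uten_acomm (deg0_mem (qd_deg0 f) ai) (deg0_mem (qd_deg0 g) bj)).
Qed.

Program Definition uten_assoc A B C : mor (uten (uten A B) C) (uten A (uten B C)) :=
  @QdMor K (uten (uten A B) C) (uten A (uten B C))
    (sassoc (qgen A) (qgen B) (qgen C)) _ _.
Next Obligation.
move=> A B C; apply: (deg0_gsum (V := qgen (uten A B))); first apply: deg0_gsum.
- by rewrite sassoc_sinll; apply: (@deg0_sinl _ _ (qgen (uten B C))).
- rewrite sassoc_sinlr.
  exact: deg0_comp (@deg0_sinr _ _ (qgen (uten B C))) (@deg0_sinl _ _ _).
- rewrite sassoc_sinr.
  exact: deg0_comp (@deg0_sinr _ _ (qgen (uten B C))) (@deg0_sinr _ _ _).
Qed.
Next Obligation.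
move=> A B C; apply/limg_subP.
apply: (uten_rel_ind (A := uten A B) (B := C)
  (gspanned_sum (gspanned_homog _) (gspanned_homog _)) (gspanned_homog _)).
- apply: (uten_rel_ind (A := A) (B := B) (gspanned_homog _) (gspanned_homog _)).
  + by move=> r rA; rewrite sassoc_sinll; apply: (mem_uten_l (uten B C) rA).
  + move=> s sB; rewrite sassoc_sinlr tmap_comp comp_lfunE.
    exact: (mem_uten_r A (mem_uten_l C sB)).
  + move=> i j a b ai bj; rewrite -!comp_lfunE sassoc_sinll sassoc_sinlr comp_lfunE.
    exact: (mem_uten_acomm (B := uten B C) ai (deg0_mem (@deg0_sinl _ _ _) bj)).
- move=> t tC; rewrite sassoc_sinr tmap_comp comp_lfunE.
  exact: (mem_uten_r A (mem_uten_r B tC)).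
move=> i j _ c [a ai|b bi] cj;
  rewrite -!comp_lfunE ?sassoc_sinll ?sassoc_sinlr sassoc_sinr !comp_lfunE.
  exact: (mem_uten_acomm (B := uten B C) ai (deg0_mem (@deg0_sinr _ _ _) cj)).
rewrite -tmap_acomm; exact: (mem_uten_r A (mem_uten_acomm bi cj)).
Qed.

Program Definition uten_assocV A B C : mor (uten A (uten B C)) (uten (uten A B) C) :=
  @QdMor K (uten A (uten B C)) (uten (uten A B) C)
    (sassocV (qgen A) (qgen B) (qgen C)) _ _.
Next Obligation.
move=> A B C; apply: (deg0_gsum (W := qgen (uten B C))); last apply: deg0_gsum.
- rewrite sassocV_sinl.
  exact: deg0_comp (@deg0_sinl _ (qgen (uten A B)) _) (@deg0_sinl _ _ _).
- rewrite sassocV_sinrl.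
  exact: deg0_comp (@deg0_sinl _ (qgen (uten A B)) _) (@deg0_sinr _ _ _).
- by rewrite sassocV_sinrr; apply: (@deg0_sinr _ (qgen (uten A B))).
Qed.
Next Obligation.
move=> A B C; apply/limg_subP.
apply: (uten_rel_ind (A := A) (B := uten B C)
  (gspanned_homog _) (gspanned_sum (gspanned_homog _) (gspanned_homog _))).
- move=> r rA; rewrite sassocV_sinl tmap_comp comp_lfunE.
  exact: (mem_uten_l C (mem_uten_l B rA)).
- apply: (uten_rel_ind (A := B) (B := C) (gspanned_homog _) (gspanned_homog _)).
  + move=> s sB; rewrite sassocV_sinrl tmap_comp comp_lfunE.
    exact: (mem_uten_l C (mem_uten_r A sB)).
  + by move=> t tC; rewrite sassocV_sinrr; apply: (mem_uten_r (uten A B) tC).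
  + move=> i j b c bi cj; rewrite -!comp_lfunE sassocV_sinrl sassocV_sinrr comp_lfunE.
    exact: (mem_uten_acomm (A := uten A B) (deg0_mem (@deg0_sinr _ _ _) bi) cj).
move=> i j a _ ai [b bj|c cj];
  rewrite -!comp_lfunE ?sassocV_sinrl ?sassocV_sinrr sassocV_sinl !comp_lfunE.
  rewrite -tmap_acomm; exact: (mem_uten_l C (mem_uten_acomm ai bj)).
exact: (mem_uten_acomm (A := uten A B) (deg0_mem (@deg0_sinl _ _ _) ai) cj).
Qed.

Program Definition uten_lunit A : mor (uten (uten_unit K) A) A :=
  @QdMor K (uten (uten_unit K) A) A (slunit (qgen A)) _ _.
Next Obligation.
move=> A; apply: (deg0_gsum (V := gzero)); rewrite ?slunit_sinl ?slunit_sinr.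
  exact: deg0_0.
exact: deg0_id.
Qed.
Next Obligation.
move=> A; apply/limg_subP.
apply: (uten_rel_ind (A := uten_unit K) (B := A) (gspanned_homog _) (gspanned_homog _)).
- by move=> r _; rewrite slunit_sinl tmap0l zero_lfunE mem0v.
- by move=> s sA; rewrite slunit_sinr tmap_id id_lfunE.
move=> i j a b _ _; rewrite -!comp_lfunE slunit_sinl zero_lfunE.
by rewrite /acomm pure0l pure0r scaler0 addr0 mem0v.
Qed.

Program Definition uten_lunitV A : mor A (uten (uten_unit K) A) :=
  @QdMor K A (uten (uten_unit K) A) (sinr (nullv K) (qgen A)) _ _.
Next Obligation. by move=> A; apply: (@deg0_sinr _ gzero). Qed.
Next Obligation. by move=> A; apply/limg_subP => r; apply: (mem_uten_r (uten_unit K)). Qed.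

Program Definition uten_runit A : mor (uten A (uten_unit K)) A :=
  @QdMor K (uten A (uten_unit K)) A (srunit (qgen A)) _ _.
Next Obligation.
move=> A; apply: (deg0_gsum (W := gzero)); rewrite ?srunit_sinl ?srunit_sinr.
  exact: deg0_id.
exact: deg0_0.
Qed.
Next Obligation.
move=> A; apply/limg_subP.
apply: (uten_rel_ind (A := A) (B := uten_unit K) (gspanned_homog _) (gspanned_homog _)).
- by move=> s sA; rewrite srunit_sinl tmap_id id_lfunE.
- by move=> r _; rewrite srunit_sinr tmap0l zero_lfunE mem0v.
move=> i j a b _ _; rewrite -!comp_lfunE srunit_sinr zero_lfunE.
by rewrite /acomm pure0l pure0r scaler0 addr0 mem0v.
Qed.

Program Definition uten_runitV A : mor A (uten A (uten_unit K)) :=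
  @QdMor K A (uten A (uten_unit K)) (sinl (qgen A) (nullv K)) _ _.
Next Obligation. by move=> A; apply: (@deg0_sinl _ _ gzero). Qed.
Next Obligation. by move=> A; apply/limg_subP => r; apply: (mem_uten_l (uten_unit K)). Qed.

Program Definition uten_monoidal : monoidal (@uten K) (uten_unit K) := {|
  tenm := uten_mor;
  assoc := uten_assoc;
  assocV := uten_assocV;
  lunit := uten_lunit;
  lunitV := uten_lunitV;
  runit := uten_runit;
  runitV := uten_runitV |}.
Next Obligation.
by move=> A B; apply/qd_mor_inj/lfunP => -[a b]; rewrite /= smapE !id_lfunE.
Qed.
Next Obligation.
by move=> *; apply/qd_mor_inj/lfunP => -[a b]; rewrite /= comp_lfunE !smapE !comp_lfunE.
Qed.
Next Obligation.
move=> A B C; apply/qd_mor_inj/lfunP => -[[a b] c].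
by rewrite /= comp_lfunE sassocE sassocVE id_lfunE.
Qed.
Next Obligation.
move=> A B C; apply/qd_mor_inj/lfunP => -[a [b c]].
by rewrite /= comp_lfunE sassocVE sassocE id_lfunE.
Qed.
Next Obligation.
move=> A A' B B' C C' f g h; apply/qd_mor_inj/lfunP => -[[a b] c].
by rewrite /= !comp_lfunE !(smapE, sassocE).
Qed.
Next Obligation.
move=> A; apply/qd_mor_inj/lfunP => -[z a].
by rewrite /= comp_lfunE slunitE sinrE id_lfunE (nullv_eq0 z).
Qed.
Next Obligation.
by move=> A; apply/qd_mor_inj/lfunP => a; rewrite /= comp_lfunE slunitE sinrE id_lfunE.
Qed.
Next Obligation.
by move=> A A' f; apply/qd_mor_inj/lfunP => -[z a]; rewrite /= !comp_lfunE !slunitE smapE.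
Qed.
Next Obligation.
move=> A; apply/qd_mor_inj/lfunP => -[a z].
by rewrite /= comp_lfunE srunitE sinlE id_lfunE (nullv_eq0 z).
Qed.
Next Obligation.
by move=> A; apply/qd_mor_inj/lfunP => a; rewrite /= comp_lfunE srunitE sinlE id_lfunE.
Qed.
Next Obligation.
by move=> A A' f; apply/qd_mor_inj/lfunP => -[a z]; rewrite /= !comp_lfunE !srunitE smapE.
Qed.
Next Obligation.
move=> A B C D; apply/qd_mor_inj/lfunP => -[[[a b] c] d].
by rewrite /= !comp_lfunE !(smapE, sassocE) !id_lfunE.
Qed.
Next Obligation.
move=> A B; apply/qd_mor_inj/lfunP => -[[a z] b].
by rewrite /= !comp_lfunE !(smapE, sassocE, slunitE, srunitE) !id_lfunE.
Qed.

Lemma uten_monoidalP : uten_structure uten_monoidal.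
Proof. by split. Qed.

End UtenMonoidal.

(** * The lax structure *)

Section LaxStructure.
Variable K : fieldType.
Implicit Types A B C : QD K.

Definition interchange A A' B B' :
    mor (bullet (uten A A') (uten B B')) (uten (bullet A B) (bullet A' B')) :=
  @QdMor K (bullet (uten A A') (uten B B')) (uten (bullet A B) (bullet A' B'))
    (pr14 (qgen A) (qgen A') (qgen B) (qgen B'))
    (@deg0_pr14 _ _ _ _ _) (@pr14_rel _ A A' B B').

(** The unit constraint must send 1 to (1, 1) for the unit axioms to hold.  It
    respects the relations because the cross terms of (1, 1) ⊗ (1, 1) are the
    anticommutator of the two copies of 1, which have degree 0. *)
Program Definition unit_diagonal :
    mor (bullet_unit K) (uten (bullet_unit K) (bullet_unit K)) :=
  @QdMor K (bullet_unit K) (uten (bullet_unit K) (bullet_unit K))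
    (sinl (ground K) (ground K) + sinr (ground K) (ground K)) _ _.
Next Obligation.
apply: (deg0_spanned (gspanned_homog gone)) => n c cn; rewrite lfunE /=.
exact: memvD (deg0_mem (V := gone) (@deg0_sinl _ _ gone) cn)
  (deg0_mem (V := gone) (@deg0_sinr _ gone _) cn).
Qed.
Next Obligation.
set R := qrel (uten _ _).
pose l := sinl (ground K) (ground K); pose r := sinr (ground K) (ground K).
apply/limg_subP => x _; rewrite memv_preim (_ : (_ @^-1: R)%VS = fullv) ?memvf //.
apply: tens_full => c d.
rewrite -memv_preim tmap_pure.
have -> : (l + r)%R c ⊗ (l + r)%R d
    = tmap l l (c ⊗ d) + acomm (0 * 0) (l c) (r d) + tmap r r (c ⊗ d).
  (* in a line, both sides are the product of c and d times the same tensor *)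
  have swap : r c ⊗ l d = r d ⊗ l c.
    have e (y : ground K) : y = (y : K) *: (1 : ground K) by rewrite [RHS]mulr1.
    by rewrite [in LHS](e c) [in LHS](e d) [in RHS](e c) [in RHS](e d) !linearZ /=
      !pureZl !pureZr !scalerA mulrC.
  rewrite !lfunE /= !pureDl !pureDr !tmap_pure /acomm expr0z scale1r -swap.
  by rewrite !addrA; congr (_ + _).
apply: memvD; first apply: memvD.
- exact: (mem_uten_l (A := bullet_unit K) _ (memvf _)).
- exact: (mem_uten_acomm (A := bullet_unit K) (B := bullet_unit K) (mem_gone c) (mem_gone d)).
- exact: (mem_uten_r _ (B := bullet_unit K) (memvf _)).
Qed.

Lemma lax_interchange : lax_two_monoidal (bullet_monoidal K) (uten_monoidal K) interchange.
Proof.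
split.
- move=> [A A'] [C C'] [B B'] [D D'] [f f'] [g g']; apply: qd_mor_inj; apply: tens_ext => x y.
  by rewrite /= !comp_lfunE tmap_pure !pr14_pure !smapE /= !tmap_pure.
- move=> [A A'] [B B'] [C C']; apply: qd_mor_inj.
  apply: (gspanned_ext (V := qgen (bullet (bullet (uten A A') (uten B B')) (uten C C')))
    (gspanned_pure (gspanned_pure (gspanned_homog _) (gspanned_homog _)) (gspanned_homog _))).
  move=> _ _ [_ _ _ z [_ _ x y _ _] _].
  rewrite /= !comp_lfunE tassoc_pure !tmap_pure !id_lfunE !pr14_pure smapE /=.
  by rewrite !tassoc_pure.
exists unit_diagonal; split=> -[A A']; apply: qd_mor_inj; apply: tens_ext.
- move=> c [a a']; rewrite /= !comp_lfunE tmap_pure id_lfunE tlunit_pure lfunE /=.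
  by rewrite sinlE sinrE pr14_pure smapE /= !tlunit_pure addr0 add0r.
- move=> [a a'] c; rewrite /= !comp_lfunE tmap_pure id_lfunE trunit_pure lfunE /=.
  by rewrite sinlE sinrE pr14_pure smapE /= !trunit_pure addr0 add0r.
Qed.

End LaxStructure.

Theorem proposition3p1 (K : fieldType) (charK : 2%N \notin [pchar K]) :
  (forall A A' B B' : QD K,
     let pr := pr14 (qgen A) (qgen A') (qgen B) (qgen B') in
     (tmap pr pr @: qrel (bullet (uten A A') (uten B B'))
      <= qrel (uten (bullet A B) (bullet A' B')))%VS)
  /\
  (exists (MB : monoidal (@bullet K) (bullet_unit K))
          (MU : monoidal (@uten K) (uten_unit K))
          (phi : forall A A' B B' : QD K,
             mor (bullet (uten A A') (uten B B')) (uten (bullet A B) (bullet A' B'))),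
     [/\ bullet_structure MB,
         uten_structure MU,
         (forall A A' B B' : QD K,
            qd_map (phi A A' B B') = pr14 (qgen A) (qgen A') (qgen B) (qgen B'))
       & lax_two_monoidal MB MU phi]).
Proof.
split=> [A A' B B'|]; first exact: pr14_rel.
exists (bullet_monoidal K), (uten_monoidal K), (@interchange K); split.
- exact: bullet_monoidalP.
- exact: uten_monoidalP.
- by [].
- exact: lax_interchange.
Qed.
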